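(* Let $\mathcal{C}$ be a root class of groups and let $G$ be the free product of a family of residually $\mathcal{C}$-groups $A_i$ ($i \in \mathcal{I}$). Let $\{\mathcal{V}_j \mid j \in \mathcal{J}\}$ be a family of varieties of groups, each $\mathcal{V}_j$ ($j \in \mathcal{J}$) being distinct from the variety of all groups, and let $\mathcal{V} = \bigcup_{j \in \mathcal{J}} \mathcal{V}_j$. Then a $\mathcal{V}$-subgroup $H$ of $G$ is $\mathcal{C}$-defective in $G$ if and only if $H$ is conjugate in $G$ to a $\mathcal{V}$-subgroup $H'$ of $A_i$ for some $i \in \mathcal{I}$ such that $H'$ is $\mathcal{C}$-defective in the group $A_i$. In particular, if for every $i \in \mathcal{I}$ all $\mathfrak{P}(\mathcal{C})'$-isolated $\mathcal{V}$-subgroups of $A_i$ are $\mathcal{C}$-separable in $A_i$, then all $\mathfrak{P}(\mathcal{C})'$-isolated $\mathcal{V}$-subgroups of $G$ are $\mathcal{C}$-separable in $G$.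
   Context: Classes of groups are, as usual, closed under isomorphism. A class of groups $\mathcal{C}$ is a root class if it contains non-trivial groups and is closed under taking subgroups and unrestricted wreath products (the unrestricted wreath product of $X$ and $Y$ is the semidirect product of the full Cartesian power $X^Y$ by $Y$, with $Y$ acting by permuting coordinates via translation). A subgroup $Y$ of a group $X$ is $\mathcal{C}$-separable in $X$ if for any $x \in X \setminus Y$ there is a homomorphism $\sigma$ of $X$ onto a group from $\mathcal{C}$ with $x\sigma \notin Y\sigma$. A group $X$ is residually a $\mathcal{C}$-group (a residually $\mathcal{C}$-group) if its trivial subgroup is $\mathcal{C}$-separable in $X$. $\mathfrak{P}(\mathcal{C})$ is the following set of primes: if $\mathcal{C}$ contains a non-periodic group, it is the set of all primes; otherwise, a prime $p$ belongs to it if and only if $p$ divides the order of an element of some group in $\mathcal{C}$. A subgroup $Y$ of $X$ is $\mathfrak{P}(\mathcal{C})'$-isolated in $X$ if for each $x \in X$ and each prime $q \notin \mathfrak{P}(\mathcal{C})$, $x^q \in Y$ implies $x \in Y$. A subgroup of $X$ is $\mathcal{C}$-defective in $X$ if it is $\mathfrak{P}(\mathcal{C})'$-isolated in $X$ but not $\mathcal{C}$-separable in $X$. A $\mathcal{V}$-subgroup is a subgroup that, as a group, belongs to the class $\mathcal{V}$. A variety of groups is the class of all groups satisfying a given set of identities. Free products are ordinary free products, and the free factors are regarded as subgroups of the free product. *)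

(* Defs.v *)
(* Possibly infinite groups are [groupType]s; classical axioms only supply
   decidable equality and choice on function types. *)
From HB Require Import structures.
From mathcomp Require Import all_boot.
From mathcomp Require Import boolp.

Set Implicit Arguments.
Unset Strict Implicit.
Unset Printing Implicit Defensive.

Local Open Scope group_scope.

Definition group_class := groupType -> Prop.

Definition isomorphic (X Y : groupType) : Prop :=
  exists f : {multiplicative X -> Y}, bijective f.

Definition iso_closed (C : group_class) : Prop :=
  forall X Y : groupType, isomorphic X Y -> C X -> C Y.

(* Subgroups of [X] are the [H : groupClosed X], i.e. boolean predicates
   containing 1 and closed under products and inverses; classically every
   subset of [X] is a boolean predicate. [group_of H] is [H] as a group. *)
Section GroupOf.
Variables (X : groupType) (H : groupClosed X).

Definition group_of := {x : X | x \in H}.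

HB.instance Definition _ := SubChoice.on group_of.

Lemma group_of_closed : group_closed H.
Proof. by split; [exact: gpred1 | move=> x y; exact: gpredF]. Qed.

HB.instance Definition _ :=
  SubChoice_isSubGroup.Build X (mem H) group_of group_of_closed.

End GroupOf.

Section TrivialSubgroup.
Variable X : groupType.

Let one_pred : {pred X} := pred1 1.

Lemma one_pred1 : 1 \in one_pred.
Proof. by rewrite inE. Qed.

Lemma one_predM : mulg_closed one_pred.
Proof. by move=> x y; rewrite !inE => /eqP-> /eqP->; rewrite mulg1. Qed.

Lemma one_predV : invg_closed one_pred.
Proof. by move=> x; rewrite !inE => /eqP->; rewrite invg1. Qed.

Definition trivial_subgroup : groupClosed X :=
  HB.pack one_pred (isMul1Closed.Build X one_pred one_pred1)
    (isMulClosed.Build X one_pred one_predM)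
    (isInvClosed.Build X one_pred one_predV).

End TrivialSubgroup.

(* The unrestricted wreath product: the pair [(f, y)] is the element [f * y]
   of the semidirect product of the full power [Y -> X] by [Y], where [y] maps
   [g] to [fun t => g (t * y)]. *)
Section Wreath.
Variables X Y : groupType.

Definition wreath : Type := ((Y -> X) * Y)%type.

HB.instance Definition _ := Choice.copy wreath ((Y -> X) * Y)%type.

Definition wreath_one : wreath := (fun=> 1, 1).
Definition wreath_mul (u v : wreath) : wreath :=
  (fun t => u.1 t * v.1 (t * u.2), u.2 * v.2).
Definition wreath_inv (u : wreath) : wreath :=
  (fun t => (u.1 (t * u.2^-1))^-1, u.2^-1).

Lemma wreath_mulA : associative wreath_mul.
Proof.
move=> u v w; rewrite /wreath_mul /=; congr pair; last by rewrite mulgA.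
by apply/funext => t; rewrite !mulgA.
Qed.

Lemma wreath_mul1 : left_id wreath_one wreath_mul.
Proof.
move=> [f y]; rewrite /wreath_mul /=; congr pair; last by rewrite mul1g.
by apply/funext => t; rewrite mul1g mulg1.
Qed.

Lemma wreath_1mul : right_id wreath_one wreath_mul.
Proof.
move=> [f y]; rewrite /wreath_mul /=; congr pair; last by rewrite mulg1.
by apply/funext => t; rewrite mulg1.
Qed.

Lemma wreath_mulV : left_inverse wreath_one wreath_inv wreath_mul.
Proof.
move=> [f y]; rewrite /wreath_mul /wreath_inv /=; congr pair.
  by apply/funext => t; rewrite mulVg.
by rewrite mulVg.
Qed.

Lemma wreath_Vmul : right_inverse wreath_one wreath_inv wreath_mul.
Proof.
move=> [f y]; rewrite /wreath_mul /wreath_inv /=; congr pair.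
  by apply/funext => t; rewrite mulgK mulgV.
by rewrite mulgV.
Qed.

HB.instance Definition _ := isGroup.Build wreath
  wreath_mulA wreath_mul1 wreath_1mul wreath_mulV wreath_Vmul.

End Wreath.

Record root_class (C : group_class) : Prop := RootClass {
  root_iso : iso_closed C;
  root_nontrivial : exists2 X : groupType, C X & exists x : X, x != 1;
  root_subgroup : forall (X : groupType) (H : groupClosed X),
    C X -> C (group_of H);
  root_wreath : forall X Y : groupType, C X -> C Y -> C (wreath X Y)
}.

Definition separable (C : group_class) (X : groupType) (Y : groupClosed X)
    : Prop :=
  forall x : X, x \notin Y ->
    exists K : groupType, C K /\
    exists sigma : {multiplicative X -> K},
      (forall k : K, exists z : X, sigma z = k) /\
      ~ (exists2 y : X, y \in Y & sigma y = sigma x).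

Definition residually (C : group_class) (X : groupType) : Prop :=
  separable C (trivial_subgroup X).

Definition has_order (X : groupType) (x : X) (n : nat) : Prop :=
  [/\ (0 < n)%N, x ^+ n = 1 &
      forall m : nat, (0 < m < n)%N -> x ^+ m <> 1].

Definition periodic (X : groupType) : Prop :=
  forall x : X, exists n : nat, has_order x n.

Definition class_primes (C : group_class) (p : nat) : Prop :=
  prime p /\
  ((exists2 X : groupType, C X & ~ periodic X) \/
   (exists2 X : groupType, C X &
      exists (x : X) (n : nat), has_order x n /\ (p %| n)%N)).

Definition primes'_isolated (C : group_class) (X : groupType)
    (Y : groupClosed X) : Prop :=
  forall (x : X) (q : nat), prime q -> ~ class_primes C q ->
    x ^+ q \in Y -> x \in Y.

Definition defective (C : group_class) (X : groupType) (Y : groupClosed X)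
    : Prop :=
  primes'_isolated C Y /\ ~ separable C Y.

(* A word in the variables x_0, x_1, ...; the letter [(k, true)] stands for
   the inverse of x_k. The word [w] represents the identity [w = 1]. *)
Definition word := seq (nat * bool).

Definition word_eval (X : groupType) (v : nat -> X) (w : word) : X :=
  \prod_(l <- w) (if l.2 then (v l.1)^-1 else v l.1).

Definition satisfies (X : groupType) (w : word) : Prop :=
  forall v : nat -> X, word_eval v w = 1.

Definition is_variety (V : group_class) : Prop :=
  exists W : word -> Prop,
    forall X : groupType, V X <-> (forall w : word, W w -> satisfies X w).

Definition class_union (J : Type) (V : J -> group_class) : group_class :=
  fun X => exists j : J, V j X.

(* [G], with the maps [iota i], is the coproduct of the groups [A i]; the
   [iota i] are then injective, and identify [A i] with a subgroup of [G]. *)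
Definition is_free_product (I : Type) (A : I -> groupType) (G : groupType)
    (iota : forall i : I, {multiplicative A i -> G}) : Prop :=
  forall (K : groupType) (f : forall i : I, {multiplicative A i -> K}),
    exists2 h : {multiplicative G -> K},
      forall (i : I) (a : A i), h (iota i a) = f i a &
      forall h' : {multiplicative G -> K},
        (forall (i : I) (a : A i), h' (iota i a) = f i a) -> h' =1 h.

(* [H] is the conjugate of the image of [H'] under [f] by [g]. *)
Definition conj_image (B G : groupType) (f : {multiplicative B -> G})
    (H' : groupClosed B) (g : G) (H : groupClosed G) : Prop :=
  forall x : G, x \in H <-> exists2 b : B, b \in H' & x = f b ^ g.

(* Main.v *)
Require Import Defs.
From HB Require Import structures.
From mathcomp Require Import all_boot.
From mathcomp Require Import boolp.
From mathcomp Require Import zify.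

(** Write [G] for the free product of the [A i], and call an element of [G]
    elliptic if it lies in a conjugate of a factor, hyperbolic otherwise.

    The argument rests on one family of homomorphisms. Given [s0 : G -> Y] and
    functions [c i : Y -> X], conjugating [s0] by [c i] on the factor [A i]
    inside the wreath product of [X] and [Y] defines a homomorphism on all of
    [G], since the factors are free of one another ([twist_hom]). If [c] is
    supported at a single index and a single point of [Y], with value [x], then
    a word that never arrives at that point by a letter of that index takes a
    power of [x] as its value, and the exponent counts its departures from
    there ([twist_delta_hom]). Root classes are closed under wreath products,
    so this separates every reduced nonempty word from 1 by an induction on its
    length ([reduced_detected]). Thus [G] is residually in the class, and as a
    by-product normal forms are unique. The same homomorphisms give, for a
    hyperbolic [u] and a prime [p] of the class, a quotient in the class where
    the order of [u] is infinite or divisible by [p] ([dvd_order_hom]).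

    Let [H] satisfy a nontrivial identity. If [H] is nontrivial and has no
    hyperbolic element, it is conjugate into a factor [A i]
    ([no_hyperbolic_conj_factor]). There, separability passes from [A i] to [G]
    because [A i] is a retract of a residually-[C] group
    ([conj_image_separable]), and isolation passes to [G] because centralizers
    of nontrivial elements of [A i] stay in [A i] ([conj_image_isolated]).

    If [H] contains a hyperbolic element and is isolated, it is separable
    ([isolated_hyperbolic_separable]). Let [L] be the set of all [x] that no
    homomorphism to a group of the class separates from [H]. As [G] is
    residually in the class, [L] satisfies the identities of [H]. By ping-pong,
    an identity forces every [g] in [L] to conjugate a hyperbolic [u] in [L] to
    [u] or [u^-1] ([same_axis]): otherwise [u] and its conjugate by [g] would
    have powers generating a free group. If moreover [u] is a shortest
    hyperbolic element of [L], its centralizer in [L] is the cyclic group it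
    generates ([centralizer_shortest]), so [L] is infinite cyclic or infinite
    dihedral. The least [m > 0] with [u^m] in [H] must then be 1: a prime
    divisor [p] of [m] belongs to the class by isolation, and [dvd_order_hom]
    separates [u] from [H]. This gives [L = H] ([isolated_axis],
    [closure_sub]). *)

Set Implicit Arguments.
Unset Strict Implicit.
Unset Printing Implicit Defensive.

Local Open Scope group_scope.

(** * Homomorphisms and subgroups *)
Section Homomorphisms.
Variables (X Y : groupType) (f : {multiplicative X -> Y}).

Lemma hom1 : f 1 = 1.
Proof. by apply: (@mulgI _ (f 1)); rewrite -gmulfM !mulg1. Qed.

Lemma homV x : f x^-1 = (f x)^-1.
Proof. by apply/esym/mulg1_eq; rewrite -gmulfM mulgV hom1. Qed.

Lemma homX x n : f (x ^+ n) = f x ^+ n.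
Proof. by elim: n => [|n IH]; rewrite ?hom1 // !expgS gmulfM IH. Qed.

Lemma homJ x y : f (x ^ y) = f x ^ f y.
Proof. by rewrite !conjgE !gmulfM homV. Qed.

Lemma homR x y : f [~ x, y] = [~ f x, f y].
Proof. by rewrite !commgEl gmulfM homV homJ. Qed.

End Homomorphisms.

Definition mk_hom (X Y : groupType) (f : X -> Y)
    (fM : {morph f : x y / x * y}) : {multiplicative X -> Y} :=
  HB.pack f (isMultiplicative.Build X Y f fM).

Lemma comp_homM (X Y Z : groupType) (g : {multiplicative Y -> Z})
  (f : {multiplicative X -> Y}) : {morph g \o f : x y / x * y}.
Proof. by move=> x y /=; rewrite !gmulfM. Qed.

Definition hom_comp (X Y Z : groupType) (g : {multiplicative Y -> Z})
    (f : {multiplicative X -> Y}) : {multiplicative X -> Z} :=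
  mk_hom (comp_homM g f).

Lemma triv_homM (X Y : groupType) : {morph (fun _ : X => 1 : Y) : x y / x * y}.
Proof. by move=> x y; rewrite mulg1. Qed.

Definition triv_hom (X Y : groupType) : {multiplicative X -> Y} :=
  mk_hom (@triv_homM X Y).

Definition id_hom (X : groupType) : {multiplicative X -> X} :=
  mk_hom (fun x y : X => erefl (x * y)).

Lemma conj_homM (X : groupType) (g : X) :
  {morph (fun x => x ^ g) : x y / x * y}.
Proof. by move=> x y; rewrite conjMg. Qed.

Definition conj_hom (X : groupType) (g : X) : {multiplicative X -> X} :=
  mk_hom (@conj_homM X g).

Section SubgroupOfProp.
Variables (X : groupType) (P : X -> Prop).
Hypotheses (P1 : P 1) (PM : forall x y, P x -> P y -> P (x * y))
  (PV : forall x, P x -> P x^-1).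

Let pr : {pred X} := fun x => `[< P x >].

Let pr1 : 1 \in pr. Proof. exact/asboolP. Qed.
Let prM : mulg_closed pr.
Proof. by move=> x y /asboolP Px /asboolP Py; apply/asboolP/PM. Qed.
Let prV : invg_closed pr.
Proof. by move=> x /asboolP Px; apply/asboolP/PV. Qed.

(** Opaque on purpose: membership in the subgroups built from it is then used
    only through [mk_subgroupP] and is never unfolded by simplification. *)
Fact subgroup_of_prop : {H : groupClosed X | forall x, x \in H <-> P x}.
Proof.
exists (HB.pack_for (groupClosed X) pr (isMul1Closed.Build X pr pr1)
  (isMulClosed.Build X pr prM) (isInvClosed.Build X pr prV)).
by move=> x; split => /asboolP.
Qed.

Definition mk_subgroup : groupClosed X := sval subgroup_of_prop.

Lemma mk_subgroupP x : x \in mk_subgroup <-> P x.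
Proof. exact: svalP subgroup_of_prop x. Qed.

End SubgroupOfProp.

Section Corestriction.
Variables (X Y : groupType) (f : {multiplicative X -> Y}) (H : groupClosed Y).
Hypothesis fH : forall x, f x \in H.

Let cor (x : X) : group_of H := exist _ (f x) (fH x).

Let corM : {morph cor : x y / x * y}.
Proof. by move=> x y; apply: val_inj; rewrite /= gmulfM. Qed.

Definition corestr : {multiplicative X -> group_of H} := mk_hom corM.

End Corestriction.

Lemma incl_homM (X : groupType) (H : groupClosed X) :
  {morph (fun x : group_of H => val x) : x y / x * y}.
Proof. by []. Qed.

Definition incl (X : groupType) (H : groupClosed X) :
  {multiplicative group_of H -> X} := mk_hom (@incl_homM X H).

Section Image.
Variables (X Y : groupType) (f : {multiplicative X -> Y}).
Let P y := exists x, f x = y.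
Let P1 : P 1. Proof. by exists 1; rewrite hom1. Qed.
Let PM x y : P x -> P y -> P (x * y).
Proof. by move=> [a <-] [b <-]; exists (a * b); rewrite gmulfM. Qed.
Let PV x : P x -> P x^-1.
Proof. by move=> [a <-]; exists a^-1; rewrite homV. Qed.

Definition hom_image : groupClosed Y := mk_subgroup P1 PM PV.
Lemma hom_imageP y : y \in hom_image <-> exists x, f x = y.
Proof. exact: mk_subgroupP. Qed.
End Image.

Section Preimage.
Variables (X Y : groupType) (f : {multiplicative X -> Y}) (S : groupClosed Y).
Let P x := f x \in S.
Let P1 : P 1. Proof. by rewrite /P hom1 gpred1. Qed.
Let PM x y : P x -> P y -> P (x * y).
Proof. by rewrite /P gmulfM => Px Py; rewrite gpredM. Qed.
Let PV x : P x -> P x^-1.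
Proof. by rewrite /P homV gpredV. Qed.

Definition hom_preim : groupClosed X := mk_subgroup P1 PM PV.
Lemma hom_preimP x : x \in hom_preim <-> f x \in S.
Proof. exact: mk_subgroupP. Qed.
End Preimage.

(** * Separation by homomorphisms to groups of a root class *)
Section Separation.
Variables (C : group_class) (C_root : root_class C).

(** Surjectivity costs nothing: a root class is closed under subgroups, so a
    homomorphism can be corestricted to its image. *)
Lemma separable_intro (X : groupType) (Y : groupClosed X) :
  (forall x, x \notin Y -> exists2 K : groupType, C K &
     exists s : {multiplicative X -> K}, forall y, y \in Y -> s y <> s x) ->
  separable C Y.
Proof.
move=> sep x /sep[K CK [s sYx]].
exists (group_of (hom_image s)); split; first exact: root_subgroup.
have sI z : s z \in hom_image s by apply/hom_imageP; exists z.
exists (corestr sI); split=> [[k kI] | [y Yy /(congr1 val)]].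
  have /hom_imageP[z zk] := kI; exists z; exact: val_inj.
exact: sYx.
Qed.

Lemma residually_intro (X : groupType) :
  (forall x : X, x != 1 -> exists2 K : groupType, C K &
     exists s : {multiplicative X -> K}, s x <> 1) ->
  residually C X.
Proof.
move=> res; apply: separable_intro => x x1.
have /res[K CK [s sx]] : x != 1 by exact: x1.
by exists K => //; exists s => y /eqP->; rewrite hom1 => /esym.
Qed.

Lemma residually_elim (X : groupType) (x : X) : residually C X -> x != 1 ->
  exists2 K : groupType, C K & exists s : {multiplicative X -> K}, s x <> 1.
Proof.
move=> /(_ x) res x1; have x0 : x \notin trivial_subgroup X by exact: x1.
have [K [CK [s [_ sx]]]] := res x0.
exists K => //; exists s => sx1; apply: sx; exists 1; last by rewrite sx1 hom1.
exact: gpred1.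
Qed.

(** The direct product of [K] and [L] sits in their wreath product, as the
    constant functions together with [L]. *)
Lemma pair_hom (X K L : groupType) (s : {multiplicative X -> K})
    (r : {multiplicative X -> L}) : C K -> C L ->
  exists2 M : groupType, C M & exists q : {multiplicative X -> M},
    forall x y, q x = q y -> s x = s y /\ r x = r y.
Proof.
move=> CK CL; exists (wreath K L); first exact: root_wreath.
have qM : {morph (fun x => ((fun=> s x), r x) : wreath K L) : x y / x * y}.
  by move=> x y; rewrite !gmulfM.
by exists (mk_hom qM) => x y /= [] /(congr1 (@^~ 1)).
Qed.

Lemma separate_list (X : groupType) (xs : seq X) :
  (forall x, x \in xs -> exists2 K : groupType, C K &
     exists s : {multiplicative X -> K}, s x <> 1) ->
  exists2 K : groupType, C K &
    exists s : {multiplicative X -> K}, forall x, x \in xs -> s x <> 1.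
Proof.
elim: xs => [|x xs IH] sep.
  have [K CK _] := root_nontrivial C_root.
  by exists K => //; exists (triv_hom X K).
have [K CK [s sx]] := sep x (mem_head _ _).
have [|L CL [r rxs]] := IH; first by move=> y yxs; apply: sep;
  rewrite inE yxs orbT.
have [M CM [q qP]] := pair_hom s r CK CL.
have q1 := hom1 q.
exists M => //; exists q => y; rewrite inE => /orP[/eqP->|/rxs ry] qy.
  by case: (qP x 1) => [|sx1 _]; rewrite ?qy ?q1 //; apply: sx;
    rewrite sx1 hom1.
by case: (qP y 1) => [|_ ry1]; rewrite ?qy ?q1 //; apply: ry; rewrite ry1 hom1.
Qed.

End Separation.

(** The order of [x] is infinite or a multiple of [d]; [dvd_order 0] says that
    it is infinite. This covers at once the two ways in which a prime can
    belong to the set of primes of a class. *)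
Definition dvd_order (X : groupType) (d : nat) (x : X) :=
  forall k, x ^+ k = 1 -> (d %| k)%N.

Lemma has_order_dvd (X : groupType) (x : X) n k :
  has_order x n -> x ^+ k = 1 -> (n %| k)%N.
Proof.
move=> [n0 xn nmin] xk; rewrite /dvdn; apply/negPn/negP => r0.
case: (nmin (k %% n)%N); first by rewrite ltn_mod n0 lt0n r0.
by move: xk; rewrite {1}(divn_eq k n) expgnDr mulnC expgnA xn expg1n mul1g.
Qed.

Lemma finite_or_infinite_order (X : groupType) (x : X) :
  (exists n, has_order x n) \/ dvd_order 0 x.
Proof.
have [[k k0 xk]|no] := pselect (exists2 k, (0 < k)%N & x ^+ k = 1).
  left; have ex : exists k, (0 < k)%N && (x ^+ k == 1).
    by exists k; rewrite k0 xk eqxx.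
  case: (ex_minnP ex) => n /andP[n0 /eqP xn] nmin; exists n; split=> // m.
  case/andP=> m0 mn xm; move: (nmin m); rewrite m0 xm eqxx => /(_ isT).
  by rewrite leqNgt mn.
right=> -[|k] xk //; case: no; by exists k.+1.
Qed.

Lemma dvd_order_trans (X : groupType) (x : X) d e :
  (e %| d)%N -> dvd_order d x -> dvd_order e x.
Proof. by move=> ed dx k /dx; apply: dvdn_trans. Qed.

Lemma dvd_order_root (X : groupType) (x : X) d n :
  dvd_order d (x ^+ n) -> dvd_order d x.
Proof. by move=> h k xk; apply: h; rewrite expgnAC xk expg1n. Qed.

Section Primes.
Variables (C : group_class) (C_root : root_class C).

Lemma class_prime_element p : class_primes C p ->
  exists2 X : groupType, C X & exists x : X, dvd_order p x.
Proof.
case=> _ [[X CX /existsNP[x nx]]|[X CX [x [n [xn pn]]]]]; exists X => //;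
  exists x.
  by case: (finite_or_infinite_order x) => // /(dvd_order_trans (dvdn0 p)).
by move=> k /(has_order_dvd xn); apply: dvdn_trans.
Qed.

Lemma torsion_class_prime (X : groupType) (x : X) q :
  residually C X -> prime q -> x ^+ q = 1 -> x != 1 -> class_primes C q.
Proof.
move=> res pq xq /(residually_elim res)[K CK [s sx]]; split=> //; right.
exists K => //; exists (s x), q; split=> //; split; first exact: prime_gt0.
  by rewrite -homX xq hom1.
move=> m /andP[m0 mq] sm; apply: sx.
have cop : coprime q m by rewrite prime_coprime // gtnNdvd.
have [a b ab _] := egcdnP m (prime_gt0 pq).
move: ab; rewrite (eqP cop) addn1 => ab.
have sxq : s x ^+ q = 1 by rewrite -homX xq hom1.
have := congr1 (fun k => s x ^+ k) ab => /=.
by rewrite mulnC expgnA sxq expg1n expgSr mulnC expgnA sm expg1n mul1g => <-.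
Qed.

Lemma exists_class_prime : exists p, class_primes C p.
Proof.
have [X CX [x x1]] := root_nontrivial C_root.
have [[n xn]|h0] := finite_or_infinite_order x.
  have n1 : (1 < n)%N.
    case: xn => n0 xn _; case: n n0 xn => [|[|n]] //= _ x11.
    by case/eqP: x1.
  exists (pdiv n); split; first exact: pdiv_prime.
  by right; exists X => //; exists x, n; split=> //; apply: pdiv_dvd.
(* A non-periodic group in the class puts every prime in the set. *)
exists 2%N; split=> //; left; exists X => // per.
have [n [n0 xn _]] := per x; by move: (h0 n xn); rewrite dvd0n; case: n n0 {xn}.
Qed.

(** Let [z] be the product of [y] with the function supported at 1 with value
    [x]. If [y] has finite order [n], the point 1 is met exactly once among 1,
    y, ..., y^(n-1), so the function part of [z^n] has value [x] at 1, and the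
    orders of [x] and [y] multiply. *)
Lemma dvd_order_wreath (X Y : groupType) (x : X) (y : Y) d e :
  dvd_order d x -> dvd_order e y ->
  dvd_order (d * e)%N (((fun t => if t == 1 then x else 1), y) : wreath X Y).
Proof.
move=> hx hy k; set z := (_, y) : wreath X Y => zk.
have z2 m : (z ^+ m).2 = y ^+ m.
  by elim: m => // m IH; rewrite !expgS /= IH.
have yk : y ^+ k = 1 by rewrite -z2 zk.
have [[n yn]|h0] := finite_or_infinite_order y; last first.
  by move/h0: yk; rewrite dvd0n => /eqP->; rewrite dvdn0.
have [n0 yn1 nmin] := yn.
have z1 m : (m < n)%N -> (z ^+ m.+1).1 1 = x.
  elim: m => [|m IH] mn; first by rewrite expg1 /= eqxx.
  rewrite expgSr /= IH ?(ltnW mn) // mul1g z2.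
  case: eqP => [ym|]; last by rewrite mulg1.
  by case: (nmin m.+1); rewrite // mn andbT.
have zn j : (z ^+ (n * j)).1 1 = x ^+ j.
  elim: j => [|j IH]; first by rewrite muln0.
  rewrite mulnSr expgnDr /= IH mul1g z2 expgnA yn1 expg1n expgSr; congr (_ * _).
  by case: n n0 z1 {yn yn1 nmin IH} => // n _ z1; rewrite z1.
have nk := has_order_dvd yn yk; case/dvdnP: nk => j jE.
have xj : x ^+ j = 1 by rewrite -zn mulnC -jE zk.
rewrite jE; apply: dvdn_mul; [exact: hx | exact: hy].
Qed.

Lemma dvd_order_primepow p e : class_primes C p ->
  exists2 X : groupType, C X & exists x : X, dvd_order (p ^ e)%N x.
Proof.
move=> pC; have [Y CY [y hy]] := class_prime_element pC.
elim: e => [|e [X CX [x hx]]]; first by exists Y => //; exists y => k _;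
  rewrite dvd1n.
exists (wreath X Y); first exact: root_wreath.
by eexists; rewrite expnSr; apply: dvd_order_wreath hx hy.
Qed.

(** Exponents counted along a path are known only up to a bound [n]; an element
    whose order is divisible by a power of [p] exceeding [n] tolerates this. *)
Lemma dvd_order_powers p n : class_primes C p ->
  exists2 X : groupType, C X & exists x : X,
    forall M, (0 < M <= n)%N -> dvd_order p (x ^+ M).
Proof.
move=> pC; have [X CX [x hx]] := dvd_order_primepow n.+1 pC.
have [pp _] := pC.
exists X => //; exists x => M /andP[M0 Mn] k; rewrite -expgnA => /hx pe.
rewrite -[(p %| k)%N]negbK -prime_coprime //; apply/negP => cop.
move: pe; rewrite Gauss_dvdl ?coprimeXl // => /(dvdn_leq M0); rewrite leqNgt.
by rewrite (leq_ltn_trans Mn) // (ltn_trans (ltnSn n)) // ltn_expl // prime_gt1.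
Qed.

End Primes.

(** * Identities and ping-pong *)
Definition no_cancel (l m : nat * bool) := (l.1 == m.1) ==> (l.2 == m.2).
Definition irreducible_word (w : word) := sorted no_cancel w.

Lemma word_eval_cons (X : groupType) (v : nat -> X) l w :
  word_eval v (l :: w) = (if l.2 then (v l.1)^-1 else v l.1) * word_eval v w.
Proof. by rewrite /word_eval big_cons. Qed.

Lemma word_eval_nil (X : groupType) (v : nat -> X) : word_eval v [::] = 1.
Proof. by rewrite /word_eval big_nil. Qed.

Lemma irreducible_word_exists (w : word) : exists2 w', irreducible_word w' &
  forall (X : groupType) (v : nat -> X), word_eval v w = word_eval v w'.
Proof.
elim: w => [|[k e] w [w' iw' ww']]; first by exists [::].
case: w' iw' ww' => [|[k' e'] w'] iw' ww'.
  by exists [:: (k, e)] => // X v; rewrite !word_eval_cons ww'.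
have [ok|] := boolP (no_cancel (k, e) (k', e')).
  exists [:: (k, e), (k', e') & w']; first by rewrite /irreducible_word /= ok.
  by move=> X v; rewrite word_eval_cons ww' -word_eval_cons.
rewrite /no_cancel negb_imply /= => /andP[/eqP kk ee].
exists w'; first exact: path_sorted iw'.
move=> X v; rewrite word_eval_cons ww' word_eval_cons /= -kk mulgA.
by case: e e' ee {iw' ww'} => [] [] //= _; rewrite ?mulVg ?mulgV mul1g.
Qed.

Lemma word_eval_hom (X Y : groupType) (f : {multiplicative X -> Y}) v w :
  f (word_eval v w) = word_eval (fun k => f (v k)) w.
Proof.
elim: w => [|l w IH]; first by rewrite !word_eval_nil hom1.
by rewrite !word_eval_cons gmulfM IH; case: l.2; rewrite ?homV.
Qed.

Section Varieties.
Variables (J : Type) (V : J -> group_class).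
Hypothesis V_variety : forall j : J, is_variety (V j).
Hypothesis V_proper : forall j : J, ~ (forall X : groupType, V j X).

(** A proper variety has an identity that fails in some group. Free reduction
    preserves all values of a word, hence leaves a nonempty reduced word. *)
Lemma variety_identity (G : groupType) (H : groupClosed G) :
  class_union V (group_of H) ->
  exists w, [/\ w != [::], irreducible_word w &
    forall v, (forall k, v k \in H) -> word_eval v w = 1].
Proof.
move=> [j VH]; have [W WP] := V_variety j.
have [X nVX] : exists X, ~ V j X by apply/existsNP/V_proper.
have [w Ww nXw] : exists2 w, W w & ~ satisfies X w.
  apply: contrapT => no; apply: nVX; apply/WP => w Ww; apply: contrapT => nX.
  by apply: no; exists w.
have [w' iw' ww'] := irreducible_word_exists w; exists w'; split=> //.
  apply/eqP => w'0; apply: nXw => v; rewrite ww' w'0; exact: word_eval_nil.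
move=> v vH; pose v' k : group_of H := exist _ (v k) (vH k).
have := (WP (group_of H)).1 VH w Ww v'; rewrite ww' => /(congr1 val).
by rewrite -[val _]/(incl H _) word_eval_hom => ->;
  rewrite -[LHS]/(incl H 1) hom1.
Qed.

End Varieties.

Lemma variety_subgroup (V : group_class) (X Y : groupType)
  (f : {multiplicative X -> Y}) : is_variety V -> injective f -> V Y -> V X.
Proof.
move=> [W WP] fI /WP VY; apply/WP => w /VY Yw v; apply: fI.
by rewrite word_eval_hom hom1; apply: Yw.
Qed.

Lemma conj_image_class_union (J : Type) (V : J -> group_class)
    (B G : groupType) (f : {multiplicative B -> G}) (S : groupClosed B) z
    (H : groupClosed G) :
  (forall j, is_variety (V j)) -> injective f -> conj_image f S z H ->
  class_union V (group_of H) -> class_union V (group_of S).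
Proof.
move=> Vv fI SH [j VH]; exists j.
have fH (x : group_of S) : hom_comp (conj_hom z) (hom_comp f (incl S)) x \in H.
  by apply/SH; exists (val x) => //; apply: valP.
apply: (@variety_subgroup _ _ _ (corestr fH)) VH; first exact: Vv.
by move=> x y /(congr1 val) /= /conjg_inj/fI/val_inj.
Qed.

(** The table-tennis argument for [a] and its conjugate [b] by [g^-1]. The set
    [P false] attracts under [a], [P true] under [a^-1]; their translates by
    [g] play these roles for [b], and [away] says that translates and originals
    are disjoint. The variable [x_k] is sent to the conjugate of [b] by
    [a^-(k+1)], so that distinct variables are separated by a nonzero power of
    [a]. *)
Section PingPong.
Variables (G : groupType) (a g z : G) (P : bool -> G -> Prop).
Let ae (e : bool) := if e then a^-1 else a.
Hypothesis step : forall e x, ~ P (~~ e) x -> P e (ae e * x).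
Hypothesis disj : forall x, P false x -> ~ P true x.
Hypothesis away : forall x e d, P e x -> P d (g^-1 * x) -> False.
Hypothesis base : forall e, ~ P e z.

Lemma ping_pong_disjoint e x : P e x -> ~ P (~~ e) x.
Proof. by case: e => [Pt Pf|]; [apply: (disj Pf)|apply: disj]. Qed.

Lemma ping_pong_expg e n x : (forall d, ~ P d x) -> P e (ae e ^+ n.+1 * x).
Proof.
move=> nx; elim: n => [|n IH]; first exact: step.
by rewrite expgS -mulgA; apply/step/ping_pong_disjoint.
Qed.

Definition ping_pong_val k := (a ^ g^-1) ^ a ^- k.+1.

Lemma ping_pong_valE k (e : bool) :
  (if e then (ping_pong_val k)^-1 else ping_pong_val k) =
  a ^+ k.+1 * g * ae e * g^-1 * a ^- k.+1.
Proof.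
rewrite /ping_pong_val; case: e; rewrite -?conjVg /ae !conjgE !invgK !mulgA //.
Qed.

(** After undoing the conjugation that belongs to its first letter, the value
    of a reduced word moves [z] into the attracting set of that letter. Two
    consecutive letters in the same variable have the same sign; in different
    variables, a nonzero power of [a] intervenes. *)
Lemma ping_pong_word k e w : irreducible_word ((k, e) :: w) ->
  P e (g^-1 * (a ^- k.+1 * (word_eval ping_pong_val ((k, e) :: w) * z))).
Proof.
elim: w k e => [|[k' e'] w IH] k e iw;
  rewrite word_eval_cons /= ping_pong_valE -!mulgA mulKg mulKg; apply: step.
  move=> /(away (e := true) _); apply; rewrite word_eval_nil mul1g.
  by have := ping_pong_expg true k base; rewrite /= expVgn.
case/andP: iw => kk iw; have Py := IH _ _ iw.
move: kk; rewrite /no_cancel /=; have [e0|kk'] /= := eqVneq k k'.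
  by move=> /eqP ->; rewrite e0; apply: ping_pong_disjoint.
move=> _; set y := word_eval _ _ * z in Py *.
have ny d : ~ P d (a ^- k'.+1 * y) by move=> Pd; apply: away Pd Py.
have -> : a ^- k.+1 * y = a ^- k.+1 * a ^+ k'.+1 * (a ^- k'.+1 * y).
  by rewrite -mulgA mulVKg.
have [d [n ->]] : exists d n, a ^- k.+1 * a ^+ k'.+1 = ae d ^+ n.+1.
  have [lk|lk] := ltnP k k'.
    exists false, (k' - k).-1.
    have -> : k'.+1 = (k.+1 + (k' - k).-1.+1)%N by lia.
    by rewrite expgnDr mulKg.
  exists true, (k - k').-1.
  have -> : k.+1 = (k'.+1 + (k - k').-1.+1)%N by move/eqP: kk'; lia.
  by rewrite expgnDr invgM mulgVK /= expVgn.
move=> Pd; exact: (away (ping_pong_expg d n ny) Pd).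
Qed.

Lemma ping_pong w : w != [::] -> irreducible_word w ->
  word_eval ping_pong_val w <> 1.
Proof.
case: w => // [[k e] w] _ iw w1; have := ping_pong_word iw; rewrite w1 mul1g.
move=> /(away (e := true) _); apply.
by have := ping_pong_expg true k base; rewrite /= expVgn.
Qed.

End PingPong.

(** * Reduced words in a free product *)
Section FreeProduct.
Variables (I : eqType) (A : I -> groupType) (G : groupType).
Variable emb : forall i : I, {multiplicative A i -> G}.

Definition factor (i : I) : groupClosed G := hom_image (emb i).

Lemma factorP i g : g \in factor i <-> exists a, emb i a = g.
Proof. exact: hom_imageP. Qed.

Lemma emb_factor i a : emb i a \in factor i.
Proof. by apply/factorP; exists a. Qed.

(** A letter records its index next to its value in [G]. Keeping the value in
    [G] rather than in [A i] lets letters of equal index be multiplied without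
    transporting along equalities of indices. *)
Notation letter := (I * G)%type.
Implicit Types (l m : letter) (s t w : seq letter).

Definition letter_ok l := (l.2 \in factor l.1) && (l.2 != 1).
Definition idx_neq l m := l.1 != m.1.
Definition reduced s := all letter_ok s && sorted idx_neq s.
Definition spell s : G := \prod_(l <- s) l.2.

Lemma spell_nil : spell [::] = 1. Proof. by rewrite /spell big_nil. Qed.

Lemma spell_cons l s : spell (l :: s) = l.2 * spell s.
Proof. by rewrite /spell big_cons. Qed.

Lemma spell_cat s t : spell (s ++ t) = spell s * spell t.
Proof. by rewrite /spell big_cat. Qed.

Lemma spell_rcons s l : spell (rcons s l) = spell s * l.2.
Proof. by rewrite -cats1 spell_cat spell_cons spell_nil mulg1. Qed.

Definition inv_word s := rev [seq (l.1, l.2^-1) | l <- s].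

Lemma spell_inv s : spell (inv_word s) = (spell s)^-1.
Proof.
elim: s => [|l s IH]; first by rewrite spell_nil invg1.
by rewrite /inv_word /= rev_cons spell_rcons spell_cons invgM -IH.
Qed.

Lemma size_inv s : size (inv_word s) = size s.
Proof. by rewrite size_rev size_map. Qed.

Lemma reduced_letters s : reduced s -> all letter_ok s.
Proof. by case/andP. Qed.

Lemma reduced_nil : reduced [::]. Proof. by []. Qed.

Lemma reduced_cons l m s : reduced [:: l, m & s] =
  [&& letter_ok l, l.1 != m.1 & reduced (m :: s)].
Proof.
rewrite /reduced /= /idx_neq.
by case: (letter_ok l); case: (letter_ok m); case: (l.1 != m.1);
  case: (all _ _).
Qed.

Lemma reduced_catl s t : reduced (s ++ t) -> reduced s.
Proof.
by rewrite /reduced all_cat; case/andP=> /andP[-> _]; case/cat_sorted2.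
Qed.

Lemma reduced_catr s t : reduced (s ++ t) -> reduced t.
Proof.
by rewrite /reduced all_cat; case/andP=> /andP[_ ->]; case/cat_sorted2.
Qed.

Lemma reduced_cat l s m t : reduced (rcons s l ++ m :: t) =
  [&& reduced (rcons s l), l.1 != m.1 & reduced (m :: t)].
Proof.
rewrite /reduced all_cat.
have -> : sorted idx_neq (rcons s l ++ m :: t) =
   [&& sorted idx_neq (rcons s l), idx_neq l m & sorted idx_neq (m :: t)].
  by case: s => [|h s] //=; rewrite cat_path last_rcons.
rewrite /idx_neq; case: (all _ _); case: (all _ _); case: (l.1 != m.1);
by case: (sorted _ _); case: (sorted _ _).
Qed.

Lemma reduced_inv s : reduced s -> reduced (inv_word s).
Proof.
case/andP=> ok so; apply/andP; split.
  rewrite all_rev all_map; apply: sub_all ok => l /= /andP[lf l1].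
  by rewrite /letter_ok /= gpredV lf invg_eq1.
rewrite rev_sorted sorted_map; apply: sub_sorted so => l m.
by rewrite /idx_neq /= eq_sym.
Qed.

Lemma lmul_word l s : letter_ok l -> reduced s ->
  exists p c, [/\ (size p <= 1)%N, (c <= 1)%N, reduced (p ++ drop c s)
    & spell (p ++ drop c s) = l.2 * spell s].
Proof.
move=> lok; case: s => [|m s] rs.
  exists [:: l], 0%N; rewrite spell_cons; split=> //;
    by rewrite /reduced /= lok.
have [lm|lm] := eqVneq l.1 m.1; last first.
  by exists [:: l], 0%N; split=> //;
    [rewrite /= reduced_cons lok lm|rewrite /= spell_cons].
have rs' : reduced s by rewrite -[m :: s]/([:: m] ++ s) in rs;
  apply: reduced_catr rs.
have [e|ne] := eqVneq (l.2 * m.2) 1.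
  by exists [::], 1%N; split=> //=; rewrite drop0 // spell_cons mulgA e mul1g.
exists [:: (l.1, l.2 * m.2)], 1%N; split=> //=; rewrite drop0; last first.
  by rewrite !spell_cons mulgA.
move: lok; case/andP=> lf _;
  move/reduced_letters: (rs) => /= /andP[/andP[mf _] _].
have ok : letter_ok (l.1, l.2 * m.2) by rewrite /letter_ok /= ne gpredM // lm.
case: s rs {rs'} => [|k s]; first by rewrite /reduced /= ok.
by rewrite !reduced_cons ok /= lm => /andP[_].
Qed.

(** Each letter on the left cancels or merges with at most one letter of the
    reduced word, so multiplication leaves all but a bounded prefix unchanged.
    *)
Lemma mul_word w s : all letter_ok w -> reduced s ->
  exists p c, [/\ (size p <= size w)%N, (c <= size w)%N, reduced (p ++ drop c s)
    & spell (p ++ drop c s) = spell w * spell s].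
Proof.
move=> + rs; elim: w => [|l w IH] /=.
  by exists [::], 0%N; rewrite /= drop0 spell_nil mul1g.
case/andP=> lok /IH[p [c [sp cw rp ep]]].
have [p1 [c1 []]] := lmul_word lok rp.
rewrite drop_cat; case: ltnP => [c1p|pc1] sp1 c11.
  rewrite catA => r e; exists (p1 ++ drop c1 p), c; split=> //.
  - by rewrite size_cat size_drop; lia.
  - by rewrite ltnW.
  - by rewrite e ep spell_cons mulgA.
rewrite drop_drop => r e; exists p1, (c1 - size p + c)%N; split=> //; try lia.
by rewrite e ep spell_cons mulgA.
Qed.

Hypothesis G_free : is_free_product emb.

Lemma extend_hom (K : groupType) (f : forall i, {multiplicative A i -> K}) :
  exists h : {multiplicative G -> K}, forall i a, h (emb i a) = f i a.
Proof. by have [h hf _] := G_free f; exists h. Qed.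

Lemma extend_factor i (K : groupType) (f : {multiplicative A i -> K}) :
  exists h : {multiplicative G -> K}, (forall a, h (emb i a) = f a) /\
    forall j a, j != i -> h (emb j a) = 1.
Proof.
have [F [Fi Fj]] : exists F : forall j, {multiplicative A j -> K},
    F i = f /\ forall j, j != i -> F j = triv_hom (A j) K.
  exists (fun j => match i =P j with
    | ReflectT e => match e in _ = j return {multiplicative A j -> K} with
                    | erefl => f end
    | ReflectF _ => triv_hom (A j) K end).
  split; first by case: eqP => // e; rewrite (eq_axiomK e).
  by move=> j /eqP ji; case: eqP => // e; case: ji.
have [h hF] := extend_hom F; exists h; split=> [a|j a ji];
  rewrite hF ?Fi ?Fj //.
Qed.

Lemma emb_inj i : injective (emb i).
Proof.
have [h [hi _]] := extend_factor (id_hom (A i)).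
by move=> a b ab; rewrite -[a]hi ab hi.
Qed.

(** The products of letters form a subgroup [S] containing the factors. The
    universal property maps [G] to [S], and its uniqueness part identifies the
    composite with the inclusion as the identity of [G]. *)
Lemma reduced_word_exists g : exists2 s, reduced s & spell s = g.
Proof.
pose P g := exists2 s, all letter_ok s & spell s = g.
have P1 : P 1 by exists [::]; rewrite // spell_nil.
have PM x y : P x -> P y -> P (x * y).
  by move=> [s so <-] [t to' <-]; exists (s ++ t);
    rewrite ?spell_cat // all_cat so to'.
have PV x : P x -> P x^-1.
  move=> [s so <-]; exists (inv_word s); rewrite ?spell_inv //.
  rewrite all_rev all_map; apply: sub_all so => l /= /andP[lf l1].
  by rewrite /letter_ok /= gpredV lf invg_eq1.
pose S := mk_subgroup P1 PM PV.
have eS i a : emb i a \in S.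
  apply/mk_subgroupP; have [->|n1] := eqVneq (emb i a) 1; first exact: P1.
  exists [:: (i, emb i a)]; last by rewrite spell_cons spell_nil mulg1.
  by rewrite /= /letter_ok /= emb_factor n1.
have [h hE] := extend_hom (fun i => corestr (eS i)).
have [h0 _ uniq] := G_free emb.
have e1 : hom_comp (incl S) h =1 h0 by apply: uniq => i a /=; rewrite hE.
have e2 : id_hom G =1 h0 by apply: uniq.
have gS : g \in S by rewrite -[g]/(id_hom G g) e2 -e1 /= (valP (h g)).
have [w wo <-] : P g by apply/(mk_subgroupP P1 PM PV).
by have [p [c [_ _ r e]]] := mul_word wo reduced_nil;
  exists (p ++ drop c [::]); rewrite // e spell_nil mulg1.
Qed.

(** * Twisted homomorphisms to wreath products *)
Section Twist.
Variables (X Y : groupType) (s0 : {multiplicative G -> Y}) (c : I -> Y -> X).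

(** The conjugate of [s0 g], an element of the top group, by the function [c i]
    of the base group. *)
Definition twist i g : wreath X Y :=
  (fun y => (c i y)^-1 * c i (y * s0 g), s0 g).

Lemma twist_hom : exists q : {multiplicative G -> wreath X Y},
  forall i g, g \in factor i -> q g = twist i g.
Proof.
have fM i : {morph (fun a => twist i (emb i a)) : a b / a * b}.
  move=> a b; congr pair; last by rewrite !gmulfM.
  by apply/funext => t /=; rewrite !gmulfM !mulgA mulgK.
have [q qE] := extend_hom (fun i => mk_hom (fM i)).
by exists q => i g /factorP[a <-]; rewrite qE.
Qed.

End Twist.

(** Reading [s] from the point [y] of [Y], a letter of index [i] contributes
    [x^-1] when it departs from the point 1 and [x] when it arrives there. If
    it never arrives, all contributions have the same sign, so that nothing
    cancels; [M] is the number of departures. *)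
Lemma twist_delta_hom (X Y : groupType) (s0 : {multiplicative G -> Y})
    (x : X) (i : I) :
  exists2 q : {multiplicative G -> wreath X Y}, forall g, (q g).2 = s0 g &
    forall s (y : Y), all letter_ok s ->
    (forall s1 l s2, s = s1 ++ l :: s2 -> l.1 = i ->
       y * s0 (spell (rcons s1 l)) <> 1) ->
    exists M, [/\ (M <= size s)%N, (q (spell s)).1 y = x ^- M &
      forall l s', s = l :: s' -> l.1 = i -> y = 1 -> (0 < M)%N].
Proof.
have [q qE] := twist_hom s0 (fun j y => if (j == i) && (y == 1) then x else 1).
exists q.
  move=> g; have [s /reduced_letters + <-] := reduced_word_exists g.
  elim: s => [|l s IH]; first by rewrite spell_nil !hom1.
  by case/andP=> /andP[lf _] ok; rewrite spell_cons !gmulfM (qE _ _ lf) /= IH.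
elim=> [|l s IH] y ok no.
  by exists 0%N; rewrite spell_nil hom1 invg1.
case/andP: ok => /andP[lf _] ok.
have [|M [sM eM _]] := IH (y * s0 l.2) ok.
  move=> s1 m s2 es /(no (l :: s1) m s2); rewrite es => /(_ erefl).
  by rewrite rcons_cons spell_cons gmulfM mulgA.
rewrite spell_cons gmulfM (qE _ _ lf) /= eM.
have [li|li] := eqVneq l.1 i; last first.
  exists M; rewrite /= invg1 !mul1g; split=> //; first exact: ltnW.
  by move=> _ _ [<- _] el; rewrite el eqxx in li.
have -> : (y * s0 l.2 == 1) = false.
  by apply/eqP; have := no [::] l s erefl li;
    rewrite spell_cons spell_nil mulg1.
rewrite /= mulg1; have [y1|y1] := eqVneq y 1.
  by exists M.+1; split=> //; rewrite expgSr invgM.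
exists M; rewrite invg1 mul1g; split=> //; first exact: ltnW.
by move=> _ _ _ _ ye; rewrite ye eqxx in y1.
Qed.

(** * Free products of residually-[C] groups are residually-[C] *)
Section Detection.
Variables (C : group_class) (C_root : root_class C).
Hypothesis A_res : forall i, residually C (A i).

Definition detected g := exists2 K : groupType, C K &
  exists q : {multiplicative G -> K}, q g <> 1.

Lemma detected_conj g z : detected (g ^ z) -> detected g.
Proof.
move=> [K CK [q qg]]; exists K => //; exists q => q1; apply: qg.
by rewrite homJ q1 conj1g.
Qed.

Lemma letter_detected l : letter_ok l -> detected l.2.
Proof.
case: l => i g /andP[/= /factorP[a ag] g1].
have a1 : a != 1 by apply: contraNneq g1 => a1; rewrite -ag a1 hom1.
have [K CK [q qa]] := residually_elim (@A_res i) a1.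
have [h [hi _]] := extend_factor q.
by exists K => //; exists h; rewrite -ag hi.
Qed.

(** Induction on the length. A word whose first and last letters have the same
    index is conjugate to a shorter one. Otherwise let [q0] detect all proper
    nonempty prefixes: read from 1, the word never comes back to 1 before its
    end, where it arrives by a letter whose index differs from the first. So it
    never arrives at 1 with the index of the first letter, while the first
    letter departs from 1. *)
Lemma reduced_detected s : reduced s -> s != [::] -> detected (spell s).
Proof.
have [n] := ubnP (size s); elim: n s => // n IH s sn rs s0.
case: s sn rs s0 => // l s sn rs _.
case/lastP: s sn rs => [|s m] sn rs.
  rewrite spell_cons spell_nil mulg1; apply: letter_detected.
  by case/andP: rs => /= /andP[].
have := reduced_letters rs; rewrite /= all_rcons => /and3P[lok mok sok].
have rsm : reduced (rcons s m) by move: rs; rewrite -cat1s; apply: reduced_catr.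
have rs' : reduced s by rewrite -cats1 in rsm; apply: reduced_catl rsm.
have [lm|lm] := eqVneq l.1 m.1.
  (* Conjugation brings the last letter next to the first. *)
  apply: (@detected_conj _ m.2^-1).
  have s0 : s != [::].
    apply: contraTneq rs => ->; rewrite reduced_cons lm eqxx /= andbF //.
  rewrite conjgE invgK spell_cons spell_rcons !mulgA mulgK.
  have [e|ne] := eqVneq (m.2 * l.2) 1.
    by rewrite e mul1g; apply: IH => //; move: sn; rewrite /= size_rcons; lia.
  rewrite -[m.2 * l.2]/((l.1, m.2 * l.2).2) -spell_cons; apply: IH => //.
    by move: sn; rewrite /= size_rcons; lia.
  case: s s0 rs {sn rsm rs' sok} => // k s _; rewrite rcons_cons -rcons_cons.
  rewrite -cats1 -cat_cons => /reduced_catl;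
    rewrite !reduced_cons => /and3P[_ -> ->].
  rewrite /letter_ok /= ne !andbT; case/andP: lok => lf _;
    case/andP: mok => mf _.
  by rewrite gpredM // lm.
set w := l :: rcons s m.
pose prefs := [seq spell (take k w) | k <- iota 1 (size s).+1].
have [|Y CY [q0 q0P]] := @separate_list C C_root G prefs.
  move=> _ /mapP[k + ->]; rewrite mem_iota => /andP[k1 k2].
  apply: IH.
  - move: sn; rewrite size_take /w /= size_rcons; case: ifP; lia.
  - by move: rs; rewrite -/w -{1}(cat_take_drop k w); apply: reduced_catl.
  - by case: k k1 {k2}.
have [p pC] := exists_class_prime C_root.
have [X CX [x xh]] := dvd_order_powers C_root (size w) pC.
have [q _ qP] := twist_delta_hom q0 x l.1.
exists (wreath X Y); first exact: root_wreath.
exists q => q1; have [||M [Mw qM M0]] := qP w 1.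
- exact: reduced_letters rs.
- move=> s1 k s2 e ki; rewrite mul1g; apply: q0P.
  case/lastP: s2 e => [|s2 m'] e.
    have := congr1 (last l) e; rewrite /= last_rcons last_cat /= => mk.
    by rewrite mk ki eqxx in lm.
  apply/mapP; exists (size s1).+1; last first.
    by rewrite e -cat_rcons take_size_cat // size_rcons.
  have := congr1 size e; rewrite mem_iota /= size_rcons size_cat /= size_rcons.
  by lia.
move: qM; rewrite q1 /= => /esym/eqP; rewrite invg_eq1 => /eqP xM.
have := xh M; rewrite Mw (M0 l (rcons s m)) // => /(_ isT 1%N xM);
  rewrite dvdn1 => /eqP p1.
by case: pC; rewrite p1.
Qed.

Lemma free_product_residual : residually C G.
Proof.
apply: residually_intro => // g g1; have [s rs sg] := reduced_word_exists g.
rewrite -sg; apply: reduced_detected => //; apply: contraNneq g1 => s0.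
by rewrite -sg s0 spell_nil.
Qed.

(** * Normal forms *)
Lemma reduced_rehead l l' s : letter_ok l' -> l'.1 = l.1 ->
  reduced (l :: s) -> reduced (l' :: s).
Proof.
case: s => [|m s] ok e; first by rewrite /reduced /= ok.
by rewrite !reduced_cons ok e => /andP[].
Qed.

Lemma reduced_behead l s : reduced (l :: s) -> reduced s.
Proof. by rewrite -cat1s; apply: reduced_catr. Qed.

Lemma reduced_swap s l l' w w' : l.1 = l'.1 ->
  reduced (s ++ l :: w) -> reduced (l' :: w') -> reduced (s ++ l' :: w').
Proof.
case/lastP: s => [|s k] e //; rewrite !reduced_cat => /and3P[-> kl _] ->.
by rewrite -e kl.
Qed.

Lemma reduced_join s t w : t != [::] ->
  reduced (s ++ t) -> reduced (t ++ w) -> reduced (s ++ t ++ w).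
Proof. by case: t => // h t _ st tw; apply: reduced_swap st tw. Qed.

Lemma spell_eq1 s : reduced s -> spell s = 1 -> s = [::].
Proof.
move=> rs s1; apply/eqP/negPn/negP => s0.
by have [K _ [q []]] := reduced_detected rs s0; rewrite s1 hom1.
Qed.

(** Moving the first letter of one word to the other side produces a reduced
    word whose first index is that of the removed letter; by induction it would
    equal the rest of the first word, which cannot start with this index. *)
Lemma spell_inj s t : reduced s -> reduced t -> spell s = spell t -> s = t.
Proof.
elim: s t => [|l s IH] t rs rt.
  by rewrite spell_nil => /esym /(spell_eq1 rt) ->.
case: t rt => [|m t] rt e; first by apply: spell_eq1; rewrite // e spell_nil.
have /andP[/= /andP[lf l1] _] := reduced_letters rs.
have /andP[/= /andP[mf m1] _] := reduced_letters rt.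
have hd k w : k.1 = l.1 -> reduced (k :: w) -> spell s <> spell (k :: w).
  move=> kl rk /(IH _ (reduced_behead rs) rk) es; move: rs.
  by rewrite es reduced_cons kl eqxx andbF.
have es : spell s = l.2^-1 * spell (m :: t) by rewrite -e spell_cons mulKg.
have [lm|lm] := eqVneq l.1 m.1; last first.
  case: (hd (l.1, l.2^-1) (m :: t)); rewrite ?reduced_cons //=.
    by rewrite lm rt /letter_ok /= gpredV lf invg_eq1 l1.
  by rewrite es [RHS]spell_cons.
have [lm2|lm2] := eqVneq l.2 m.2.
  rewrite (IH t (reduced_behead rs) (reduced_behead rt)).
    by case: l m lm lm2 {rs rt e lf l1 mf m1 hd es} => [? ?] [? ?] /= -> ->.
  by rewrite es spell_cons lm2 mulKg.
case: (hd (l.1, l.2^-1 * m.2) t) => //; last by rewrite es !spell_cons mulgA.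
apply: reduced_rehead rt => //; rewrite /letter_ok /= gpredM ?gpredV // ?lm //=.
by apply: contraNneq lm2 => /mulg1_eq; rewrite invgK => ->.
Qed.

Definition nf g : seq letter := s2val (cid2 (reduced_word_exists g)).

Lemma nf_reduced g : reduced (nf g).
Proof. exact: s2valP (cid2 (reduced_word_exists g)). Qed.

Lemma spell_nf g : spell (nf g) = g.
Proof. exact: s2valP' (cid2 (reduced_word_exists g)). Qed.

Lemma nf_spell s : reduced s -> nf (spell s) = s.
Proof. by move=> rs; apply: spell_inj; rewrite ?nf_reduced ?spell_nf. Qed.

Lemma nf1 : nf 1 = [::].
Proof. by rewrite -spell_nil nf_spell. Qed.

Lemma nf_mul g h : exists p c, [/\ (size p <= size (nf g))%N,
  (c <= size (nf g))%N & nf (g * h) = p ++ drop c (nf h)].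
Proof.
have [p [c [sp cs r e]]] := mul_word (reduced_letters (nf_reduced g))
  (nf_reduced h).
by exists p, c; split=> //; rewrite -{1}[g]spell_nf -{1}[h]spell_nf -e nf_spell.
Qed.

Lemma size_nf_mul g h : (size (nf (g * h)) <= size (nf g) + size (nf h))%N.
Proof.
have [p [c [sp _ ->]]] := nf_mul g h; rewrite size_cat size_drop; lia.
Qed.

Lemma reduced_letter l : letter_ok l -> reduced [:: l].
Proof. by rewrite /reduced /= => ->. Qed.

Lemma spell_letter l : spell [:: l] = l.2.
Proof. by rewrite spell_cons spell_nil mulg1. Qed.

Lemma nf_factor i g : g \in factor i -> g != 1 -> nf g = [:: (i, g)].
Proof.
move=> gi g1; rewrite -(nf_spell (s := [:: (i, g)])) ?spell_letter //.
by apply: reduced_letter; rewrite /letter_ok /= gi.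
Qed.

Lemma size_nf_factor i g : g \in factor i -> (size (nf g) <= 1)%N.
Proof.
have [->|g1] := eqVneq g 1; first by rewrite nf1.
by move=> gi; rewrite (nf_factor gi).
Qed.

(** Equal indices at the junction cost at least one letter. *)
Lemma size_nf_merge s h l t : h.1 = l.1 -> reduced (rcons s h) ->
  reduced (l :: t) ->
  (size (nf (spell (rcons s h) * spell (l :: t))) <= size s + (size t).+1)%N.
Proof.
move=> hl rs rt; rewrite spell_rcons spell_cons -!mulgA.
apply: leq_trans (size_nf_mul _ _) _; apply: leq_add.
  by rewrite nf_spell //; move: rs; rewrite -cats1; apply: reduced_catl.
rewrite mulgA -add1n; apply: leq_trans (size_nf_mul _ _) _; apply: leq_add.
  apply: (@size_nf_factor l.1); rewrite gpredM //.
    by rewrite -hl; move: (reduced_letters rs);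
      rewrite all_rcons => /andP[/andP[]].
  by have /andP[/andP[]] := reduced_letters rt.
by rewrite nf_spell //; apply: reduced_behead rt.
Qed.

(** Representatives of the double cosets of [A i]: the middle word [c] neither
    begins nor ends with the index [i]. *)
Lemma factor_coset_form i g : exists p c q, [/\ p \in factor i, q \in factor i,
  g = p * spell c * q & c = [::] \/ forall l m, letter_ok l -> letter_ok m ->
    l.1 = i -> m.1 = i -> reduced (l :: rcons c m)].
Proof.
have [p [c [pf rc gE hc]]] : exists p c, [/\ p \in factor i, reduced c,
    g = p * spell c & forall l, letter_ok l -> l.1 = i -> reduced (l :: c)].
  rewrite -[g]spell_nf; have := nf_reduced g; case: (nf g) => [|k s] rk.
    exists 1, [::]; rewrite gpred1 mul1g; split=> // l lok _.
    exact: reduced_letter.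
  have [ki|ki] := eqVneq k.1 i.
    exists k.2, s; rewrite spell_cons; split=> //.
    - by case/andP: (reduced_letters rk) => /andP[]; rewrite ki.
    - exact: reduced_behead rk.
    - by move=> l lok li; apply: reduced_rehead rk; rewrite // li ki.
  exists 1, (k :: s); rewrite gpred1 mul1g; split=> // l lok li.
  by rewrite reduced_cons lok li eq_sym ki.
case/lastP: c rc gE hc => [|c k] rc gE hc.
  by exists p, [::], 1; rewrite gE gpred1 mulg1; split=> //; left.
have [ki|ki] := eqVneq k.1 i.
  exists p, c, k.2; rewrite gE spell_rcons mulgA; split=> //.
    by move: (reduced_letters rc); rewrite all_rcons => /andP[/andP[]];
      rewrite ki.
  case/lastP: c rc {gE} hc => [|c h] rc hc; first by left.
  right=> l m lok mok li mi.
  have r : reduced ((l :: rcons c h) ++ [:: k]) by rewrite cats1; apply: hc.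
  rewrite -[rcons (rcons c h) m]cats1 -cat_cons; apply: reduced_swap r _.
    by rewrite ki mi.
  exact: reduced_letter.
exists p, (rcons c k), 1; rewrite gpred1 mulg1; split=> //;
  right=> l m lok mok li mi.
have r := hc _ lok li.
by rewrite -cats1 -cat_cons -rcons_cons reduced_cat rcons_cons r mi ki
  reduced_letter.
Qed.

(** * Elliptic and hyperbolic elements *)

(** Cyclically reduced; a single letter is excluded, as it merges with itself.
    *)
Definition cyc_red s := (s != [::]) && reduced (s ++ s).

Lemma cyc_red_reduced s : cyc_red s -> reduced s.
Proof. by case/andP=> _ /reduced_catl. Qed.

Lemma cyc_redE l s m :
  cyc_red (l :: rcons s m) = reduced (l :: rcons s m) && (l.1 != m.1).
Proof.
rewrite /cyc_red -rcons_cons [X in reduced (_ ++ X)]rcons_cons reduced_cat.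
by rewrite rcons_cons /= [l.1 == _]eq_sym; case: (reduced (l :: rcons s m));
  rewrite ?andbT ?andbF.
Qed.

Definition hyperbolic g := exists s z, cyc_red s /\ g = spell s ^ z.

Lemma hyperbolicJ g z : hyperbolic (g ^ z) -> hyperbolic g.
Proof.
by move=> [s [y [cs e]]]; exists s, (y * z^-1); rewrite conjgM -e conjgK.
Qed.

Lemma elliptic_or_hyperbolic g :
  [\/ g = 1, exists i z, g ^ z \in factor i | hyperbolic g].
Proof.
have [n] := ubnP (size (nf g)); elim: n g => // n IH g.
have := nf_reduced g; rewrite -{3 4 5}[g]spell_nf.
case: (nf g) => [|l s] rs; first by rewrite spell_nil; constructor 1.
case/lastP: s rs => [|s m] rs sn.
  constructor 2; exists l.1, 1; rewrite conjg1 spell_letter.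
  by case/andP: (reduced_letters rs) => /andP[].
have [lm|lm] := eqVneq l.1 m.1; last first.
  by constructor 3; exists (l :: rcons s m), 1; rewrite conjg1 cyc_redE rs lm.
have := reduced_letters rs;
  rewrite /= all_rcons => /and3P[/andP[lf _] /andP[mf _] _].
set g' := spell _; have g'E : g' ^ m.2^-1 = m.2 * l.2 * spell s.
  by rewrite /g' conjgE invgK spell_cons spell_rcons !mulgA mulgK.
have rs' : reduced s.
  by move/reduced_behead: rs; rewrite -cats1; apply: reduced_catl.
have [||[i [z gz]]|hg] := IH (g' ^ m.2^-1).
- rewrite g'E; apply: leq_ltn_trans (size_nf_mul _ _) _.
  have : (size (nf (m.2 * l.2)) <= 1)%N.
    by apply: (@size_nf_factor m.1); rewrite gpredM // -lm.
  by rewrite nf_spell //; move: sn; rewrite /= size_rcons; lia.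
- by move/eqP; rewrite conjg_eq1 => /eqP->; constructor 1.
- by constructor 2; exists i, (m.2^-1 * z); rewrite conjgM.
- by constructor 3; apply: hyperbolicJ hg.
Qed.

(** Conjugate so that [a] lies in [A i] and write [b = p c q] in double coset
    form. If [c] is nonempty, [y c] is hyperbolic for each nontrivial [y] in [A
    i]; up to conjugation [b] gives [y = q p] and [a b] gives [y = q a p], and
    these are not both trivial. *)
Lemma no_hyperbolic_conj_factor (L : groupClosed G) a : a \in L -> a != 1 ->
  (forall g, g \in L -> ~ hyperbolic g) ->
  exists i z, forall g, g \in L -> g ^ z \in factor i.
Proof.
move=> aL a1 noh.
have [a0|[i [z az]]|/noh//] := elliptic_or_hyperbolic a.
  by rewrite a0 eqxx in a1.
exists i, z => b bL.
have [p [c [q [pf qf bE rc]]]] := factor_coset_form i (b ^ z).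
case: rc => [c0|rc]; first by rewrite bE c0 spell_nil mulg1 gpredM.
have hyp y : y \in factor i -> y != 1 -> hyperbolic (y * spell c).
  move=> yf y1; exists ((i, y) :: c), 1; rewrite conjg1 spell_cons; split=> //.
  have ok : letter_ok (i, y) by rewrite /letter_ok /= yf.
  rewrite /cyc_red /=; have r := rc _ _ ok ok erefl erefl.
  rewrite -[_ :: _]/(((i, y) :: c) ++ [:: (i, y)] ++ c);
    apply: reduced_join => //.
    by rewrite cats1.
  by rewrite -rcons_cons -cats1 in r; apply: reduced_catl r.
have [qp|qp] := eqVneq (q * p) 1; last first.
  case: (noh b bL); apply: (@hyperbolicJ _ (z * q^-1)); rewrite conjgM bE.
  have -> : (p * spell c * q) ^ q^-1 = q * p * spell c.
    by rewrite conjgE invgK !mulgA mulgK.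
  by apply: hyp; rewrite // gpredM.
case: (noh (a * b)); first exact: gpredM.
apply: (@hyperbolicJ _ (z * q^-1)); rewrite conjgM conjMg bE.
have -> : (a ^ z * (p * spell c * q)) ^ q^-1 = (q * a ^ z * p) * spell c.
  by rewrite conjgE invgK !mulgA mulgK.
apply: hyp; first by rewrite gpredM // gpredM.
have -> : q * a ^ z * p = (a ^ z) ^ p.
  by rewrite -(mulg1_eq qp) (conjgE (a ^ z)) invgK; apply/esym/mulgA.
by rewrite !conjg_eq1.
Qed.

(** Write [y = p c q] in double coset form. Commutation turns into an equality
    of two reduced words: a letter of index [i] followed by [c], and [c]
    followed by a letter of index [i]; it fails for nonempty [c]. *)
Lemma centralizer_factor i a y : a \in factor i -> a != 1 -> commute a y ->
  y \in factor i.
Proof.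
move=> af a1 cay; have [p [c [q [pf qf yE rc]]]] := factor_coset_form i y.
case: rc => [c0|rc]; first by rewrite yE c0 spell_nil mulg1 gpredM.
pose l := (i, a ^ p); pose m := (i, a ^ q^-1).
have lok : letter_ok l by rewrite /letter_ok /= gpredJ // conjg_eq1.
have mok : letter_ok m by rewrite /letter_ok /= gpredJ ?gpredV // conjg_eq1.
have r := rc _ _ lok mok erefl erefl.
have /spell_inj : spell (l :: c) = spell (rcons c m).
  rewrite spell_cons spell_rcons /=; apply: (mulgI p); apply: (mulIg q).
  move: (conjgC a p) (conjgCV q a).
  move: (a ^ p) (a ^ q^-1) => x1 x2 e1 e2.
  rewrite !mulgA -e1 -(mulgA (p * spell c)) -e2.
  by move: cay; rewrite /commute yE !mulgA.
have r1 : reduced (l :: c).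
  by move: r; rewrite -rcons_cons -cats1; apply: reduced_catl.
move/(_ r1 (reduced_behead r)).
case: c r {rc yE r1} => [|k c] r; last by case=> lk; move: r;
  rewrite rcons_cons reduced_cons -lk eqxx andbF.
by move: r; rewrite reduced_cons eqxx andbF.
Qed.

(** * Translation along a cyclically reduced word *)
Definition wpow s n : seq letter := flatten (nseq n s).

Lemma wpowSr s n : wpow s n.+1 = wpow s n ++ s.
Proof. by rewrite /wpow -addn1 nseqD flatten_cat /= cats0. Qed.

Lemma spell_wpow s n : spell (wpow s n) = spell s ^+ n.
Proof.
elim: n => [|n IH]; first by rewrite spell_nil.
by rewrite expgS -IH -spell_cat.
Qed.

Lemma size_wpow s n : size (wpow s n) = (n * size s)%N.
Proof. by elim: n => // n IH; rewrite [wpow _ _]/= size_cat IH mulSn. Qed.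

Lemma reduced_wpow_cat t n w :
  cyc_red t -> reduced (t ++ w) -> reduced (wpow t n ++ w).
Proof.
case/andP=> t0 rtt rtw; elim: n => [|[|n] IH]; first exact: reduced_catr rtw.
  by rewrite /wpow /= cats0.
rewrite -[wpow _ _]/(t ++ t ++ wpow t n) -!catA; apply: reduced_join => //.
by move: IH; rewrite -[wpow _ _]/(t ++ wpow t n) -catA.
Qed.

Lemma reduced_wpow t n : cyc_red t -> reduced (wpow t n).
Proof.
move=> ct; rewrite -[wpow t n]cats0; apply: reduced_wpow_cat; rewrite ?cats0 //.
exact: cyc_red_reduced.
Qed.

Lemma cyc_red_inv t : cyc_red t -> cyc_red (inv_word t).
Proof.
case/andP=> t0 r; apply/andP; split.
  by rewrite -size_eq0 size_inv size_eq0.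
by rewrite -rev_cat -map_cat; apply: reduced_inv.
Qed.

Lemma cyc_red_expg_eq1 t n : cyc_red t -> spell t ^+ n = 1 -> n = 0%N.
Proof.
move=> ct; rewrite -spell_wpow => /(spell_eq1 (reduced_wpow n ct))/(congr1
  size).
case/andP: ct => t0 _; rewrite size_wpow; case: t t0 => // l t _ /=.
by case: n.
Qed.

Definition starts i g := if nf g is l :: _ then l.1 == i else false.

Lemma reduced_cat_starts l t x : cyc_red (l :: t) -> starts l.1 x ->
  reduced ((l :: t) ++ nf x).
Proof.
case/andP=> _ r; have := nf_reduced x; rewrite /starts.
by case: (nf x) => // k w rk /eqP kl; apply: reduced_swap r rk.
Qed.

Lemma reduced_inv_cat l t x : reduced (l :: t) -> ~~ starts l.1 x ->
  reduced (inv_word (l :: t) ++ nf x).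
Proof.
move=> r; have := nf_reduced x; rewrite /starts; case: (nf x) => [|k w] rk kl.
  by rewrite cats0; apply: reduced_inv.
have := reduced_inv r; rewrite /inv_word /= rev_cons => ri.
by rewrite reduced_cat ri rk /= eq_sym kl.
Qed.

Section Translation.
Variables (l : letter) (t0 : seq letter).
Let t := l :: t0.
Let u := spell t.
Hypothesis ct : cyc_red t.

Lemma nf_starts n x : starts l.1 x -> nf (u ^+ n * x) = wpow t n ++ nf x.
Proof.
move=> sx; rewrite -{1}[x]spell_nf -spell_wpow -spell_cat nf_spell //.
by apply: reduced_wpow_cat; rewrite // reduced_cat_starts.
Qed.

Lemma nf_not_starts n x : ~~ starts l.1 x ->
  nf (u ^- n * x) = wpow (inv_word t) n ++ nf x.
Proof.
move=> sx; rewrite -{1}[x]spell_nf -expVgn -spell_inv -spell_wpow -spell_cat.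
rewrite nf_spell //; apply: reduced_wpow_cat; first exact: cyc_red_inv.
by apply: reduced_inv_cat => //; apply: cyc_red_reduced.
Qed.

Lemma starts_mul n x : starts l.1 x -> starts l.1 (u ^+ n * x).
Proof.
move=> sx; rewrite /starts nf_starts //; case: n => [|n]; first exact: sx.
by rewrite /= eqxx.
Qed.

(** Elements whose normal form begins with the [n]-th power of the word [t]
    (for [false]) or of its inverse (for [true]); see [far_nf]. The definition
    through [starts] makes the translation behaviour of these sets immediate.
    *)
Definition far n (e : bool) x :=
  if e then ~~ starts l.1 (u ^+ n * x) else starts l.1 (u ^- n * x).

Lemma far_nf n e x : far n e x ->
  exists w, nf x = wpow (if e then inv_word t else t) n ++ w.
Proof.
case: e => /= fx.
  by exists (nf (u ^+ n * x)); rewrite -nf_not_starts // mulKg.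
by exists (nf (u ^- n * x)); rewrite -nf_starts // mulVKg.
Qed.

Lemma far_step n e x : ~~ far n (~~ e) x ->
  far n e ((if e then (u ^+ (n + n))^-1 else u ^+ (n + n)) * x).
Proof.
by case: e; rewrite /= ?negbK expgnDr ?invgM !mulgA ?mulgV ?mulVg mul1g.
Qed.

Lemma far_disjoint n x : far n false x -> ~~ far n true x.
Proof.
rewrite /= negbK => /(starts_mul (n + n)).
by rewrite expgnDr -!mulgA mulVKg.
Qed.

Lemma far1 n e : ~~ far n.+1 e 1.
Proof.
have s1 : starts l.1 1 = false by rewrite /starts nf1.
case: e; rewrite /= mulg1 ?negbK.
  have := nf_spell (reduced_wpow n.+1 ct).
  by rewrite spell_wpow /starts => ->; rewrite /= eqxx.
by apply/negP => /(starts_mul n.+1); rewrite mulgV s1.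
Qed.

End Translation.

(** In a word of period [s], the window of length [size s] at position [c] is
    conjugate to [s] by the prefix of length [c]. *)
Lemma take_drop_period s n w c : (c <= n * size s)%N ->
  let W := wpow s n.+1 ++ w in
  spell s * spell (take c W) =
  spell (take c W) * spell (take (size s) (drop c W)).
Proof.
move=> cn W; rewrite -!spell_cat -takeD addnC takeD.
have WE : W = s ++ wpow s n ++ w by rewrite /W catA.
rewrite {2 3}WE take_size_cat // drop_size_cat //; congr spell; congr cat.
by rewrite /W wpowSr -catA !takel_cat ?size_wpow.
Qed.

(** Multiplication by [g] changes only short prefixes, so the periodic parts of
    [y] and [g y] share a common window of one full period. It is conjugate to
    [t1] by a prefix of [y], and to [t2] by the image of that prefix under [g].
    *)
Lemma overlap_conj g y t1 t2 n w1 w2 : size t1 = size t2 -> (0 < size t1)%N ->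
  (size (nf g) <= n)%N ->
  nf y = wpow t1 n.+1 ++ w1 -> nf (g * y) = wpow t2 n.+1 ++ w2 ->
  g * spell t1 = spell t2 * g.
Proof.
move=> st t0 gn ny ngy.
have [p [c [sp sc e]]] := nf_mul g y.
have bound d : (d <= size (nf g))%N -> (d <= n * size t1)%N.
  by move=> dg; rewrite (leq_trans dg) // (leq_trans gn) // leq_pmulr.
have := take_drop_period w1 (bound _ sc); rewrite -ny /= => e1.
have := @take_drop_period t2 n w2 (size p); rewrite -st bound // => /(_ isT).
rewrite /= -ngy e take_size_cat // drop_size_cat // => e2.
have gP : g * spell (take c (nf y)) = spell p.
  apply: (mulIg (spell (drop c (nf y))));
    rewrite -mulgA -!spell_cat cat_take_drop.
  by rewrite -e !spell_nf.
apply: (mulIg (spell (take c (nf y)))).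
by rewrite -mulgA e1 mulgA gP -e2 -mulgA gP.
Qed.

(** If the sets [far] for some large [n] were disjoint from their translates by
    [g], ping-pong with a power of [spell t] would violate the identity. A
    common element has a long periodic prefix before and after multiplication
    by [g], and [overlap_conj] applies. *)
Lemma same_axis (L : groupClosed G) t g (w : word) : cyc_red t ->
  spell t \in L -> g \in L -> w != [::] -> irreducible_word w ->
  (forall v, (forall k, v k \in L) -> word_eval v w = 1) ->
  spell t ^ g = spell t \/ spell t ^ g = (spell t)^-1.
Proof.
case: t => // l t ct uL gL w0 wi wL; set u := spell _ in uL *.
set n := size (nf g).
have [[x [e [d [fx fgx]]]]|no] := pselect (exists x e d,
    far l t n.+1 e x /\ far l t n.+1 d (g^-1 * x)); last first.
  (* Exponent [n.+1 + n.+1] carries the complement of the repelling set of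
     depth [n.+1] into the attracting set of the same depth. *)
  exfalso; pose a := u ^+ (n.+1 + n.+1).
  have aL : a \in L by apply: gpredXn.
  case: (@ping_pong G a g 1 (far l t n.+1) _ _ _ _ w w0 wi).
  - by move=> e x /negP; apply: far_step.
  - by move=> x /far_disjoint => /(_ ct) /negP.
  - by move=> x e d fx fgx; apply: no; exists x, e, d.
  - by move=> e; apply/negP/far1.
  by rewrite wL // => k; rewrite !gpredJ ?gpredV ?gpredXn.
have [w1 n1] := far_nf ct fx; have [w2 n2] := far_nf ct fgx.
pose dir e := if e then inv_word (l :: t) else l :: t.
have size_dir e' : size (dir e') = size (l :: t) by rewrite /dir; case: e';
  rewrite ?size_inv.
have := @overlap_conj g (g^-1 * x) (dir d) (dir e) n w2 w1.
rewrite mulVKg !size_dir => /(_ erefl isT (leqnn _) n2 n1).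
have conjE a b : g * a = b * g -> b ^ g = a by move=> ab;
  rewrite conjgE -ab mulKg.
rewrite /dir; case: d {fx fgx n1 n2}; case: e;
  rewrite ?spell_inv -/u => /conjE; rewrite ?conjVg;
  by [left | right | move/invg_inj; left | move=> e1; right; apply: invg_inj;
    rewrite invgK].
Qed.

Definition cyclic_powers (u : G) g := exists k, g = u ^+ k \/ g = u ^- k.

Lemma cyclic_powersM u g : cyclic_powers u g -> cyclic_powers u (u * g).
Proof.
move=> [k [->|->]]; first by exists k.+1; left; rewrite expgS.
case: k => [|k]; first by exists 1%N; left; rewrite invg1 mulg1.
by exists k; right; rewrite expgSr invgM mulVKg.
Qed.

Lemma cyclic_powersV u g : cyclic_powers u^-1 g -> cyclic_powers u g.
Proof.
by move=> [k [->|->]]; exists k; rewrite expVgn ?invgK; [right|left].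
Qed.

Section Centralizer.
Variables (L : groupClosed G) (n : nat).
Hypothesis min : forall s, cyc_red s -> spell s \in L -> (n <= size s)%N.

(** Commutation makes the concatenations [t ++ nf g] and [nf g ++ t] equal, so
    one of [t] and [nf g] is a prefix of the other. If [nf g] were the shorter
    one, it would be cyclically reduced, against minimality. *)
Lemma commute_prefix t g : cyc_red t -> size t = n -> g \in L -> g != 1 ->
  commute (spell t) g -> reduced (t ++ nf g) ->
  exists2 w, nf g = t ++ w & (size w < size (nf g))%N.
Proof.
move=> ct tn gL g1 cug rtg.
have g0 : nf g != [::] by apply: contraNneq g1 => g0;
  rewrite -[g]spell_nf g0 spell_nil.
have rgt : reduced (nf g ++ t).
  have := size_nf_mul (spell t) g.
  have e1 : nf (spell t * g) = t ++ nf g by rewrite -{1}[g]spell_nf -spell_cat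
    nf_spell.
  have := nf_reduced g; have gE := spell_nf g; move: e1; rewrite cug.
  case/lastP: (nf g) g0 gE => // s h _ gE e1 rs _.
  case: t ct tn cug rtg e1 => // l t ct tn cug rtg e1.
  rewrite reduced_cat rs (cyc_red_reduced ct) andbT /=; apply: contraT;
    rewrite negbK => /eqP hl.
  have := size_nf_merge hl rs (cyc_red_reduced ct);
    rewrite gE e1 size_cat size_rcons /=.
  by lia.
have e : t ++ nf g = nf g ++ t.
  by apply: spell_inj => //; rewrite !spell_cat spell_nf.
have t0 : (0 < size t)%N by case/andP: ct; case: (t).
have [ng|gn] := leqP (size t) (size (nf g)).
  exists (drop (size t) (nf g)); last by rewrite size_drop;
    case: (size (nf g)) ng; lia.
  have := congr1 (take (size t)) e;
    rewrite take_size_cat // takel_cat // => {1}->.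
  by rewrite cat_take_drop.
have /min : cyc_red (nf g).
  rewrite /cyc_red g0 /=; have tE : t = nf g ++ drop (size (nf g)) t.
    have := congr1 (take (size (nf g))) e;
      rewrite takel_cat ?(ltnW gn) // take_size_cat // => {1}<-.
    by rewrite cat_take_drop.
  by move: rgt; rewrite tE catA; apply: reduced_catl.
by rewrite spell_nf => /(_ gL); rewrite -tn leqNgt gn.
Qed.

(** Euclidean descent: either [t] or its inverse can be split off from the
    normal form of [g] as a prefix, according to whether [g] merges with the
    last letter of [t]. *)
Lemma centralizer_shortest t g : cyc_red t -> size t = n -> spell t \in L ->
  g \in L -> commute (spell t) g -> cyclic_powers (spell t) g.
Proof.
move=> ct tn tL.
have [N] := ubnP (size (nf g)); elim: N g => // N IH g gN gL cug.
have [->|g1] := eqVneq g 1; first by exists 0%N; left.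
have step s : cyc_red s -> size s = n -> spell s \in L -> commute (spell s) g ->
    commute (spell t) (spell s) -> reduced (s ++ nf g) ->
    exists2 h, g = spell s * h & cyclic_powers (spell t) h.
  move=> cs sn sL csg cus rsg;
    have [w ew sw] := commute_prefix cs sn gL g1 csg rsg.
  have gE : g = spell s * spell w by rewrite -spell_cat -ew spell_nf.
  have wE : spell w = (spell s)^-1 * g by rewrite gE mulKg.
  exists (spell w) => //; apply: IH.
  - apply: leq_ltn_trans (_ : size w < N)%N; last by lia.
    by rewrite nf_spell //; move: (nf_reduced g); rewrite ew;
      apply: reduced_catr.
  - by rewrite wE gpredM // gpredV.
  - by rewrite wE; apply: commuteM => //; apply: commuteV.
clear IH; case: t ct tn tL cug step => // l t ct tn tL cug step.
have [r|nr] := boolP (reduced ((l :: t) ++ nf g)).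
  have [h -> ph] := step _ ct tn tL cug (erefl _) r.
  exact: cyclic_powersM.
have ns : ~~ starts l.1 g by apply: contra nr; apply: reduced_cat_starts.
have [||||||h -> ph] := step (inv_word (l :: t)).
- exact: cyc_red_inv.
- by rewrite size_inv.
- by rewrite spell_inv gpredV.
- by rewrite spell_inv; apply/commute_sym/commuteV/commute_sym.
- by rewrite spell_inv; apply: commuteV.
- by apply: reduced_inv_cat; rewrite ?cyc_red_reduced.
rewrite spell_inv; apply: cyclic_powersV; apply: cyclic_powersM.
by apply: cyclic_powersV; rewrite invgK.
Qed.

End Centralizer.

(** * Orders of hyperbolic elements in quotients *)
Lemma expg_base (X Y : groupType) (z : wreath X Y) k y : z.2 = 1 ->
  (z ^+ k).1 y = z.1 y ^+ k.
Proof.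
by move=> z2; elim: k => // k IH; rewrite !expgS /= z2 mulg1 IH.
Qed.

Lemma wpow_prefix t n s1 k s2 : wpow t n = s1 ++ k :: s2 ->
  exists j v1 v2, rcons s1 k = wpow t j ++ rcons v1 k /\ t = v1 ++ k :: v2.
Proof.
elim: n s1 => [|n IH] s1; first by move/(congr1 size);
  rewrite size_cat /= addnS.
rewrite -[wpow _ _]/(t ++ wpow t n) => e.
have [st|ts] := ltnP (size s1) (size t).
  exists 0%N, s1, (drop (size s1).+1 t); split=> //.
  have := congr1 (take (size s1).+1) e; rewrite takel_cat // -cat_rcons.
  by rewrite take_size_cat ?size_rcons // -cat_rcons => <-;
    rewrite cat_take_drop.
have s1E : s1 = t ++ drop (size t) s1.
  have := congr1 (take (size t)) e;
    rewrite take_size_cat // takel_cat // => {1}->.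
  by rewrite cat_take_drop.
move: e; rewrite s1E -catA => /(congr1 (drop (size t)));
  rewrite !drop_size_cat //.
move=> /IH[j [v1 [v2 [e tE]]]]; exists j.+1, v1, v2; split=> //.
by rewrite rcons_cat e catA.
Qed.

(** The product with the prefix on the right is reduced, while on the other
    side two letters of the same index meet, which makes it shorter. *)
Lemma prefix_not_commute l t v1 k v2 : cyc_red (l :: t) ->
  l :: t = v1 ++ k :: v2 -> k.1 = l.1 ->
  ~ commute (spell (l :: t)) (spell (rcons v1 k)).
Proof.
move=> ct tE kl cuv; have /andP[_ rtt] := ct.
have rv : reduced (rcons v1 k).
  by have := cyc_red_reduced ct; rewrite tE -cat_rcons; apply: reduced_catl.
have := size_nf_merge kl rv (cyc_red_reduced ct);
  rewrite -cuv -spell_cat nf_spell.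
  by rewrite size_cat size_rcons /=; lia.
by move: rtt; rewrite {2}tE -cat_rcons catA; apply: reduced_catl.
Qed.

(** Choose [q0] so that the images of [u] and of the prefixes of its word that
    end with the index of the first letter still do not commute. If [q0 u] has
    finite order [N], the word of [u^N], read from 1, is a closed path. It
    never arrives at 1 with the first index: there the image of such a prefix
    would be a power of [q0 u]. Hence the twisted image of [u^N] is a base
    element whose value at 1 is [x^-M] with [0 < M <= N * size t], and [x] is
    chosen for this bound. *)
Lemma dvd_order_hom p t : class_primes C p -> cyc_red t ->
  exists2 K : groupType, C K &
    exists q : {multiplicative G -> K}, dvd_order p (q (spell t)).
Proof.
move=> pC; case: t => // l t ct; set u := spell _.
pose w := l :: t.
pose comms := [seq [~ u, spell (rcons (take k w) (nth l w k))] |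
  k <- iota 0 (size w) & (nth l w k).1 == l.1].
have [|Y CY [q0 q0P]] := @separate_list C C_root G comms.
  move=> _ /mapP[k + ->]; rewrite mem_filter mem_iota => /andP[/eqP kl /= kw].
  apply: residually_elim; first exact: free_product_residual.
  apply/negP => /commgP; apply: (prefix_not_commute (v2 := drop k.+1 w)) kl =>
    //.
  by rewrite -drop_nth ?cat_take_drop.
have [[N uN]|h0] := finite_or_infinite_order (q0 u); last first.
  by exists Y => //; exists q0; apply: dvd_order_trans h0; apply: dvdn0.
have [X CX [x xh]] := dvd_order_powers C_root (size (wpow w N)) pC.
have [q q2 qP] := twist_delta_hom q0 x l.1.
exists (wreath X Y); first exact: root_wreath.
exists q; apply: (@dvd_order_root _ _ _ N); rewrite -homX -spell_wpow => k.
have [N0 q0N _] := uN.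
have [||M [Mw qM M0]] := qP (wpow w N) 1.
- exact: reduced_letters (reduced_wpow N ct).
- move=> s1 m s2 /wpow_prefix[j [v1 [v2 [-> wE]]]] ml;
  rewrite mul1g spell_cat spell_wpow.
  rewrite gmulfM homX => e.
  apply: (q0P [~ u, spell (rcons v1 m)]).
    have v1w : (size v1 < size w)%N by rewrite wE size_cat /=; lia.
    apply/mapP; exists (size v1).
      by rewrite mem_filter mem_iota /= v1w wE nth_cat ltnn subnn /= ml eqxx.
    by rewrite wE take_size_cat // nth_cat ltnn subnn.
  have e1 : q0 (spell (rcons v1 m)) = q0 u ^- j by rewrite -(mulg1_eq e).
  by rewrite homR e1 commgXVg.
have qu2 : (q (spell (wpow w N))).2 = 1 by rewrite q2 spell_wpow homX.
move=> /(congr1 (fun z : wreath X Y => z.1 1));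
  rewrite expg_base // qM /= => xk.
apply: (xh M).
  by rewrite Mw (M0 l (t ++ wpow w N.-1)) // -[in LHS](prednK N0).
by apply: invg_inj; rewrite -expVgn xk invg1.
Qed.

(** * Isolated subgroups with hyperbolic elements *)

(** In this section [L] satisfies a nontrivial identity, [t] is a shortest
    cyclically reduced word with value [u] in [L], and [H] is a subgroup that
    no homomorphism to a group of [C] distinguishes from [L]. *)
Section Axis.
Variables (t : seq letter) (L : groupClosed G) (w : word).
Hypothesis ct : cyc_red t.
Let u := spell t.
Hypothesis uL : u \in L.
Hypothesis min : forall s, cyc_red s -> spell s \in L -> (size t <= size s)%N.
Hypotheses (w0 : w != [::]) (wi : irreducible_word w).
Hypothesis wL : forall v, (forall k, v k \in L) -> word_eval v w = 1.

Lemma axis_dichotomy g : g \in L -> cyclic_powers u g \/ u ^ g = u^-1.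
Proof.
move=> gL; have [ug|] := same_axis ct uL gL w0 wi wL; last by right.
left; apply: (centralizer_shortest min) => //.
by rewrite /commute conjgC -/u ug.
Qed.

(** An element inverting [u] has a square in the cyclic group of [u] that it
    both centralizes and inverts, so it is an involution, whereas hyperbolic
    elements have infinite order. *)
Lemma hyperbolic_power h : hyperbolic h -> h \in L ->
  exists2 k, (0 < k)%N & h = u ^+ k \/ h = u ^- k.
Proof.
move=> [s [z [cs hE]]] hL.
have hn n : h ^+ n = 1 -> n = 0%N.
  by rewrite hE -conjXg => /eqP;
    rewrite conjg_eq1 => /eqP/(cyc_red_expg_eq1 cs).
case: (axis_dichotomy hL) => [[[|k] hk]|uh].
- by have := hn 1%N; case: hk => ->; rewrite ?invg1 => /(_ erefl).
- by exists k.+1.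
have h2 : cyclic_powers u (h ^+ 2).
  case: (axis_dichotomy (gpredXn 2 hL)) => // u2.
  have := conjgM u h h; rewrite uh conjVg uh invgK -[h * h]/(h ^+ 2) u2 => uu.
  apply: (centralizer_shortest min) => //; first exact: gpredXn.
  by rewrite /commute conjgC -/u u2 uu.
have [k hk] := h2.
have e1 : (u ^+ k) ^ h = u ^+ k.
  have c : commute h (u ^+ k).
    case: hk => hk; first by rewrite -hk; apply: commuteX.
    by rewrite -[u ^+ k]invgK -hk; apply/commuteV/commuteX.
  by rewrite conjgE -c mulKg.
have : u ^+ (k + k) = 1.
  rewrite expgnDr -{1}e1 conjXg uh expVgn mulVg //.
move/(cyc_red_expg_eq1 ct) => kk; have k0 : k = 0%N by lia.
by have := hn 2%N; case: hk => ->; rewrite k0 ?invg1 => /(_ erefl).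
Qed.

Variable H : groupClosed G.
Hypothesis HL : forall x, x \in H -> x \in L.
Hypothesis H_isol : primes'_isolated C H.
Hypothesis closure : forall x, x \in L -> forall K : groupType, C K ->
  forall q : {multiplicative G -> K}, exists2 y, y \in H & q y = q x.

Lemma separate_inverse : exists2 K : groupType, C K &
  exists q : {multiplicative G -> K}, (q u)^-1 <> q u.
Proof.
have u2 : u ^+ 2 != 1 by apply/eqP => /(cyc_red_expg_eq1 ct).
have [K CK [q qu]] := residually_elim free_product_residual u2.
exists K => //; exists q => e; apply: qu.
by rewrite homX expgS -{1}e mulVg.
Qed.

(** Let [m] be the least positive exponent with [u^m] in [H], and [p] a prime
    divisor of [m]. Isolation puts [p] in the set of primes of [C]. In a
    quotient where [p] divides the order of [u] and [u] differs from its
    inverse, the image of [u] is not that of a power of [u^m], nor of an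
    element inverting [u]. *)
Lemma isolated_axis h : h \in H -> hyperbolic h -> u \in H.
Proof.
move=> hH hyp; have [k0 k00 hk0] := hyperbolic_power hyp (HL hH).
have ex : exists k, (0 < k)%N && (u ^+ k \in H).
  exists k0; rewrite k00 /=; case: hk0 => e; first by rewrite -e.
  by rewrite -[u ^+ k0]invgK -e gpredV.
case: (ex_minnP ex) => m /andP[m0 umH] mmin.
have mdvd k : u ^+ k \in H -> (m %| k)%N.
  move=> ukH; rewrite /dvdn; apply/negPn/negP => r0.
  have : u ^+ (k %% m) \in H.
    have := ukH; rewrite {1}(divn_eq k m) expgnDr mulnC expgnA.
    by rewrite gpredMl // gpredXn.
  move=> urH; have := mmin (k %% m)%N; rewrite lt0n r0 urH => /(_ isT).
  by rewrite leqNgt ltn_mod m0.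
have [m1|m1] := eqVneq m 1%N; first by rewrite m1 in umH.
have pp : prime (pdiv m) by apply: pdiv_prime; lia.
have pm := pdiv_dvd m; set p := pdiv m in pp pm.
have pC : class_primes C p.
  apply: contrapT => npC; have := H_isol pp npC (x := u ^+ (m %/ p)).
  rewrite -expgnA divnK // => /(_ umH)/mdvd; apply/negP.
  rewrite gtnNdvd //; first by rewrite divn_gt0 ?prime_gt0 // dvdn_leq.
  by rewrite ltn_Pdiv // prime_gt1.
have [K CK [q qu]] := dvd_order_hom pC ct.
have [K' CK' [r ru]] := separate_inverse.
have [M CM [s sP]] := pair_hom C_root q r CK CK'.
have [y yH /sP[qy ry]] := closure uL CM s.
case: (axis_dichotomy (HL yH)) => [[k yk]|uy]; last first.
  case: ru; rewrite -homV -uy homJ ry conjgE mulKg //.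
have mk : (m %| k)%N.
  by apply: mdvd; case: yk => e; rewrite -1?[u ^+ k]invgK -e ?gpredV.
have pk := dvdn_trans pm mk.
have pN1 : ~~ (p %| 1)%N by rewrite dvdn1; move: (prime_gt1 pp); lia.
case/negP: pN1; case: yk => yk; rewrite yk ?homV homX in qy.
  case: k yk qy pk mk => [|k] yk qy pk mk; first by apply: qu; rewrite -/u -qy.
  have : (p %| k)%N.
    by apply: qu; apply: (mulIg (q u)); rewrite -expgSr mul1g.
  by move=> pk'; rewrite -(dvdn_addr _ pk') addn1.
rewrite -(dvdn_addr _ pk) addn1; apply: qu.
by rewrite expgSr -{2}/u -{2}qy mulgV.
Qed.

(** An [x] inverting [u] differs by a power of [u] from any other such element,
    so it lies in [H] as soon as [H] has one. If [H] has none, it centralizes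
    [u], and a quotient where [u] differs from its inverse separates [x]. *)
Lemma closure_sub : u \in H -> forall x, x \in L -> x \in H.
Proof.
move=> uH x xL.
have powH g : cyclic_powers u g -> g \in H.
  by move=> [k [->|->]]; rewrite ?gpredV gpredXn.
case: (axis_dichotomy xL) => [/powH//|ux].
have [[g gH ug]|no] := pselect (exists2 g, g \in H & u ^ g = u^-1).
  have gxH : g * x^-1 \in H.
    have gxL : g * x^-1 \in L by rewrite gpredM ?gpredV // HL.
    apply: powH; apply: (centralizer_shortest min) => //.
    by rewrite /commute conjgC -/u conjgM ug -ux conjgK.
  by move: gxH; rewrite gpredFl.
have [K CK [q qu]] := separate_inverse.
have [y yH qy] := closure xL CK q; case: (axis_dichotomy (HL yH)) => [py|uy].
  case: qu; rewrite -homV -ux homJ -qy -homJ; congr (q _).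
  case: py => k [->|->]; rewrite conjgE.
    by rewrite (commuteX k (erefl : commute u u)) mulKg.
  by rewrite (commuteV (commuteX k (erefl : commute u u))) mulKg.
by case: no; exists y.
Qed.

End Axis.

(** The closure [L] of [H] satisfies the identities of [H]: a nontrivial value
    of the word in [L] would survive in a group [K] of the class, where it is a
    value at elements of [H]. A conjugation brings a shortest hyperbolic
    element of [L] into cyclically reduced form. *)
Lemma isolated_hyperbolic_separable (H : groupClosed G) h (w : word) :
  h \in H -> hyperbolic h -> w != [::] -> irreducible_word w ->
  (forall v, (forall k, v k \in H) -> word_eval v w = 1) ->
  primes'_isolated C H -> separable C H.
Proof.
move=> hH hyp w0 wi wH isol.
pose P x := forall K : groupType, C K -> forall q : {multiplicative G -> K},
  exists2 y, y \in H & q y = q x.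
have P1 : P 1 by move=> K CK q; exists 1; rewrite ?gpred1.
have PM x y : P x -> P y -> P (x * y).
  move=> Px Py K CK q; have [a aH ax] := Px K CK q; have [b bH yb] := Py K CK q.
  by exists (a * b); rewrite ?gpredM // !gmulfM ax yb.
have PV x : P x -> P x^-1.
  move=> Px K CK q; have [a aH ax] := Px K CK q.
  by exists a^-1; rewrite ?gpredV // !homV ax.
pose L := mk_subgroup P1 PM PV.
have LP x : x \in L <-> P x by apply: mk_subgroupP.
have HL x : x \in H -> x \in L by move=> xH; apply/LP => K CK q; exists x.
have wL v : (forall k, v k \in L) -> word_eval v w = 1.
  move=> vL; apply: contrapT => /eqP ev.
  have [K CK [q qe]] := residually_elim free_product_residual ev.
  have /choice[v' v'P] k : exists y, y \in H /\ q y = q (v k).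
    by have /LP/(_ K CK q)[y yH qy] := vL k; exists y.
  apply: qe; rewrite word_eval_hom.
  have -> : (fun k => q (v k)) = (fun k => q (v' k)).
    by apply/funext => k; case: (v'P k).
  by rewrite -word_eval_hom wH ?hom1 // => k; case: (v'P k).
have exn : exists n, `[< exists s z, [/\ cyc_red s, spell s ^ z \in L & size s
  = n] >].
  have [s [z [cs hE]]] := hyp; exists (size s); apply/asboolP; exists s, z.
  by split=> //; rewrite -hE; apply: HL.
case: (ex_minnP exn) => n /asboolP[t [z [ct tL tn]]] nmin.
pose conjsub (S : groupClosed G) : groupClosed G := hom_preim (conj_hom z) S.
have cS S x : x \in conjsub S <-> x ^ z \in S by apply: hom_preimP.
have sub x : x \in conjsub H -> x \in conjsub L by move/cS/HL/cS.
have isolz : primes'_isolated C (conjsub H).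
  by move=> x q pq nq /cS; rewrite conjXg => /(isol _ _ pq nq)/cS.
have tLz : spell t \in conjsub L by apply/cS.
have wLz v : (forall k, v k \in conjsub L) -> word_eval v w = 1.
  move=> vL; apply/eqP; rewrite -(conjg_eq1 _ z) -[_ ^ z]/(conj_hom z _).
  by rewrite word_eval_hom wL // => k; apply/cS.
have minz s : cyc_red s -> spell s \in conjsub L -> (size t <= size s)%N.
  by move=> cs /cS sL; rewrite tn; apply: nmin; apply/asboolP; exists s, z.
have clz x : x \in conjsub L -> forall K : groupType, C K ->
    forall q : {multiplicative G -> K}, exists2 y, y \in conjsub H & q y = q x.
  move=> /cS/LP xL K CK q.
  have [y yH qy] := xL K CK (hom_comp q (conj_hom z^-1)).
  exists (y ^ z^-1); first by apply/cS; rewrite conjgKV.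
  by move: qy; rewrite /= conjgK.
have hHz : h ^ z^-1 \in conjsub H by apply/cS; rewrite conjgKV.
have hypz : hyperbolic (h ^ z^-1) by apply: (@hyperbolicJ _ z); rewrite conjgKV.
have uH := isolated_axis ct tLz minz w0 wi wLz sub isolz clz hHz hypz.
have LH := closure_sub ct tLz minz w0 wi wLz sub clz uH.
apply: separable_intro => // x xH; apply: contrapT => no.
case/negP: xH; have /LH/cS : x ^ z^-1 \in conjsub L.
  apply/cS; rewrite conjgKV; apply/LP => K CK q; apply: contrapT => nq.
  by apply: no; exists K => //; exists q => y yH e; apply: nq; exists y.
by rewrite conjgKV.
Qed.

(** * Subgroups conjugate into a factor *)
Lemma retraction i :
  exists r : {multiplicative G -> A i}, forall a, r (emb i a) = a.
Proof.
by have [r [rE _]] := extend_factor (id_hom (A i)); exists r => a; rewrite rE.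
Qed.

(** Up to conjugation let [H] be a subgroup of [A i], and let [r] be the
    retraction onto [A i]. Points of [A i] are separated from [H] by composing
    with [r]. For [x] outside [A i], let [q] distinguish [x] from [r x]: the
    pair of [q] and [q \o r] maps [A i] into the diagonal, but not [x]. *)
Lemma conj_image_separable i (B : groupClosed (A i)) z (H : groupClosed G) :
  separable C B -> conj_image (emb i) B z H -> separable C H.
Proof.
move=> sepB BH; have [r rE] := retraction i.
apply: separable_intro => // x xH; pose x' := x ^ z^-1.
have xE : x = x' ^ z by rewrite conjgKV.
have [/factorP[a ax]|x'f] := boolP (x' \in factor i).
  have /sepB[K [CK [s [_ sa]]]] : a \notin B.
    by apply: contra xH => aB; apply/BH; exists a; rewrite // ax.
  exists K => //; exists (hom_comp s (hom_comp r (conj_hom z^-1))).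
  move=> _ /BH[b bB ->] /=; rewrite conjgK rE -/x' -ax rE => e.
  by apply: sa; exists b.
have /(residually_elim free_product_residual)[K CK [q qx]] :
    x'^-1 * emb i (r x') != 1.
  apply: contraNneq x'f => /mulg1_eq; rewrite invgK => ->; exact: emb_factor.
pose c := conj_hom z^-1.
have [M CM [s sP]] := pair_hom C_root (hom_comp q c)
  (hom_comp q (hom_comp (emb i) (hom_comp r c))) CK CK.
exists M => //; exists s => _ /BH[b bB ->] /sP[] /=; rewrite conjgK rE => e1 e2.
by apply: qx; rewrite gmulfM homV -e2 e1 mulVg.
Qed.

(** If [x^q] is a nontrivial element of the factor, then [x] centralizes it. If
    [x^q = 1], then [x = 1], for otherwise [q] would be a prime of the class.
    *)
Lemma conj_image_isolated i (B : groupClosed (A i)) z (H : groupClosed G) :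
  primes'_isolated C B -> conj_image (emb i) B z H -> primes'_isolated C H.
Proof.
move=> isoB BH x q pq nq /BH[b bB xb].
have xq : (x ^ z^-1) ^+ q = emb i b by rewrite -conjXg xb conjgK.
have [b1|b1] := eqVneq (emb i b) 1.
  have [x1|x1] := eqVneq (x ^ z^-1) 1; last first.
    by case: nq; apply: (torsion_class_prime free_product_residual pq _ x1);
      rewrite xq.
  by apply/BH; exists 1; rewrite ?gpred1 // hom1 -x1 conjgKV.
have /factorP[a ax] : x ^ z^-1 \in factor i.
  apply: (centralizer_factor (emb_factor b) b1); rewrite -xq.
  exact/commute_sym/commuteX.
apply/BH; exists a; last by rewrite ax conjgKV.
apply: (isoB _ _ pq nq); suff -> : a ^+ q = b by [].
by apply: (@emb_inj i); rewrite homX ax.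
Qed.

Lemma conj_image_separableV i (B : groupClosed (A i)) z (H : groupClosed G) :
  conj_image (emb i) B z H -> separable C H -> separable C B.
Proof.
move=> BH sepH; apply: separable_intro => // a aB.
have /sepH[K [CK [s [_ sa]]]] : emb i a ^ z \notin H.
  apply: contra aB => /BH[b bB] /conjg_inj/emb_inj ab.
  by rewrite ab.
exists K => //; exists (hom_comp s (hom_comp (conj_hom z) (emb i))) => b bB /=
  e.
by apply: sa; exists (emb i b ^ z) => //; apply/BH; exists b.
Qed.

Lemma conj_imageE i z (H : groupClosed G) :
  (forall x, x \in H -> x ^ z \in factor i) ->
  conj_image (emb i) (hom_preim (hom_comp (conj_hom z^-1) (emb i)) H) z^-1 H.
Proof.
move=> HA x; split=> [xH|[b /hom_preimP bH ->] //].
have /factorP[b bx] := HA _ xH.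
exists b; last by rewrite bx conjgK.
by apply/hom_preimP; rewrite /= bx conjgK.
Qed.

Lemma conj_image_isolatedV i (B : groupClosed (A i)) z (H : groupClosed G) :
  conj_image (emb i) B z H -> primes'_isolated C H -> primes'_isolated C B.
Proof.
move=> BH isoH a q pq nq aq.
have /(isoH _ _ pq nq)/BH[b bB /conjg_inj/emb_inj->//] : (emb i a ^ z) ^+ q \in
  H.
by apply/BH; exists (a ^+ q); rewrite // homX conjXg.
Qed.

Lemma defective_iff (J : Type) (V : J -> group_class) (H : groupClosed G) :
  (forall j, is_variety (V j)) ->
  (forall j, ~ (forall X : groupType, V j X)) ->
  class_union V (group_of H) ->
  (defective C H <->
   exists (i : I) (B : groupClosed (A i)) (z : G),
     [/\ class_union V (group_of B), defective C B &
         conj_image (emb i) B z H]).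
Proof.
move=> V_variety V_proper VH; split; last first.
  move=> [i [B [z [_ [isoB nsepB] BH]]]]; split.
    exact: conj_image_isolated isoB BH.
  by move=> sepH; apply: nsepB; apply: conj_image_separableV BH sepH.
move=> [isoH nsepH].
have [w [w0 wi wH]] := variety_identity V_variety V_proper VH.
have [a aH a1] : exists2 a, a \in H & a != 1.
  apply: contrapT => no; apply: nsepH; apply: separable_intro => // x xH.
  have x1 : x != 1 by apply: contraNneq xH => ->; apply: gpred1.
  have [K CK [s sx]] := residually_elim free_product_residual x1.
  exists K => //; exists s => y yH; have [->|y1] := eqVneq y 1.
    by rewrite hom1 => /esym.
  by case: no; exists y.
have noh g : g \in H -> ~ hyperbolic g.
  move=> gH hyp; apply: nsepH.
  exact: isolated_hyperbolic_separable gH hyp w0 wi wH isoH.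
have [i [z Hz]] := no_hyperbolic_conj_factor aH a1 noh.
have BH := conj_imageE Hz.
exists i, (hom_preim (hom_comp (conj_hom z^-1) (emb i)) H), z^-1; split=> //.
  exact: conj_image_class_union V_variety (@emb_inj i) BH VH.
split; first exact: conj_image_isolatedV BH isoH.
move=> sepB; apply: nsepH; exact: conj_image_separable sepB BH.
Qed.

End Detection.
End FreeProduct.

Theorem corollary1
    (C : group_class) (C_root : root_class C)
    (I : Type) (A : I -> groupType)
    (A_res : forall i : I, residually C (A i))
    (G : groupType) (iota : forall i : I, {multiplicative A i -> G})
    (G_free : is_free_product iota)
    (J : Type) (V : J -> group_class)
    (V_variety : forall j : J, is_variety (V j))
    (V_proper : forall j : J, ~ (forall X : groupType, V j X)) :
  (forall H : groupClosed G, class_union V (group_of H) ->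
     (defective C H <->
      exists (i : I) (H' : groupClosed (A i)) (g : G),
        [/\ class_union V (group_of H'), defective C H' &
            conj_image (iota i) H' g H]))
  /\
  ((forall (i : I) (H' : groupClosed (A i)),
      class_union V (group_of H') -> primes'_isolated C H' ->
      separable C H') ->
   forall H : groupClosed G,
     class_union V (group_of H) -> primes'_isolated C H -> separable C H).
Proof.
(* Comparing indices needs a decidable equality on [I], supplied classically. *)
pose I' : eqType := HB.pack I (gen_eqMixin I).
have iff := @defective_iff I' A G iota G_free C C_root A_res J V.
split=> [H VH|sepA H VH isoH]; first exact: iff.
apply: contrapT => nsepH.
have [i [B [z [VB [isoB nsepB] _]]]] :=
  (iff H V_variety V_proper VH).1 (conj isoH nsepH).
exact/nsepB/sepA.
Qed.
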